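(* Let $K$ be an algebraically closed field. If $X,Y,Z\in\mathcal{S}_1$, then $X\ast(Y\ast Z)=(X\ast Y)\ast Z$ (equality of isomorphism classes), where $\ast$ denotes the operation of taking the generic extension.
   Context: For a partition $\lambda=(\lambda_1\ge\lambda_2\ge\dots)$ put $N_\lambda=\bigoplus_iK[T]/(T^{\lambda_i})$. $\mathcal{S}$ is the category of triples $(N_\alpha,N_\beta,f)$ with $f:N_\alpha\to N_\beta$ an injective $K[T]$-homomorphism; morphisms $(N_\alpha,N_\beta,f)\to(N_{\alpha'},N_{\beta'},f')$ are pairs $(\psi_1,\psi_2)$ of $K[T]$-homomorphisms with $f'\psi_1=\psi_2f$. $\mathcal{S}_1$ is the full subcategory of objects with $\alpha_1\le1$ (semisimple invariant subspaces). An object $Z\in\mathcal{S}_1$ is an extension of $Y\in\mathcal{S}_1$ by $X\in\mathcal{S}_1$ if there is a short exact sequence $0\to X\to Z\to Y\to0$ (exact in both components). The generic extension $Y\ast X$ of $Y$ by $X$ is the unique (up to isomorphism) extension $Z\in\mathcal{S}_1$ of $Y$ by $X$ with minimal $K$-dimension of the endomorphism ring $\operatorname{End}_{\mathcal{S}}(Z)$; over an algebraically closed field it always exists in $\mathcal{S}_1$. *)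

(* Defs.v *)
From HB Require Import structures.
From mathcomp Require Import all_boot all_order all_algebra.
From mathcomp Require Import qpoly.

Set Implicit Arguments.
Unset Strict Implicit.
Unset Printing Implicit Defensive.

Import GRing.Theory.
Local Open Scope ring_scope.

(* The zeros at the end of a partition are omitted, so that the parts are
   exactly the entries of the list.  (Note that {poly %/ 'X^0} is not the zero
   ring in the library.) *)
Definition is_partition (s : seq nat) : bool := sorted geq s && (0 \notin s)%N.

Section Category.

Variable K : fieldType.

(* The direct sum of the K[T]/(T^m), m ranging over the parts of s, with the
   action of K[T] given by act. *)
Fixpoint N (s : seq nat) : vectType K :=
  if s is m :: s' then ({poly %/ ('X^m : {poly K})} * N s')%type
  else 'rV[K]_0.

Fixpoint act (p : {poly K}) (s : seq nat) : N s -> N s :=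
  if s is m :: s' then
    fun v : {poly %/ ('X^m : {poly K})} * N s' =>
      (in_qpoly 'X^m p * v.1, act p v.2)
  else id.

(* K-linearity is part of the type 'Hom(N s, N t). *)
Definition is_KT_hom (s t : seq nat) (g : 'Hom(N s, N t)) : Prop :=
  forall (p : {poly K}) (v : N s), g (act p v) = act p (g v).

Record objS : Type := ObjS {
  alpha : seq nat;
  beta : seq nat;
  emb : 'Hom(N alpha, N beta);
  alpha_partition : is_partition alpha;
  beta_partition : is_partition beta;
  emb_hom : is_KT_hom emb;
  emb_inj : injective emb
}.

Record morS (X Y : objS) : Type := MorS {
  mor1 : 'Hom(N (alpha X), N (alpha Y));
  mor2 : 'Hom(N (beta X), N (beta Y));
  mor1_hom : is_KT_hom mor1;
  mor2_hom : is_KT_hom mor2;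
  mor_comm : (emb Y \o mor1 = mor2 \o emb X)%VF
}.

Definition isoS (X Y : objS) : Prop :=
  exists (g : morS X Y) (h : morS Y X),
    [/\ (mor1 h \o mor1 g = \1)%VF, (mor1 g \o mor1 h = \1)%VF,
        (mor2 h \o mor2 g = \1)%VF & (mor2 g \o mor2 h = \1)%VF].

Definition in_S1 (X : objS) : Prop := (head 0 (alpha X) <= 1)%N.

Definition short_exact (U V W : vectType K) (i : 'Hom(U, V)) (q : 'Hom(V, W)) :
  Prop := [/\ lker i = 0%VS, limg i = lker q & limg q = fullv].

(* Extensions of Y by X: X is the subobject and Y the quotient. *)
Definition is_extension (Y X Z : objS) : Prop :=
  in_S1 Z /\
  exists (i : morS X Z) (q : morS Z Y),
    short_exact (mor1 i) (mor1 q) /\ short_exact (mor2 i) (mor2 q).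

Definition mulT (s : seq nat) : 'End(N s) := linfun (@act 'X s).

(* The endomorphisms of Z as a K-subspace of End_K(N_alpha) * End_K(N_beta): a
   K-linear map is K[T]-linear iff it commutes with the action of T.  See
   mem_endS. *)
Definition endS_defect (Z : objS)
    (g : 'End(N (alpha Z)) * 'End(N (beta Z))) :
    'End(N (alpha Z)) * 'End(N (beta Z)) * 'Hom(N (alpha Z), N (beta Z)) :=
  ((g.1 \o mulT (alpha Z))%VF - (mulT (alpha Z) \o g.1)%VF,
   (g.2 \o mulT (beta Z))%VF - (mulT (beta Z) \o g.2)%VF,
   (emb Z \o g.1)%VF - (g.2 \o emb Z)%VF).

Definition endS (Z : objS) : {vspace 'End(N (alpha Z)) * 'End(N (beta Z))} :=
  lker (linfun (@endS_defect Z)).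

Lemma act_linear (p : {poly K}) s : linear (@act p s).
Proof.
elim: s => [|m s IH] //= a u v.
by rewrite IH /= mulrDr -scalerAr.
Qed.

Lemma act_poly_linear s (a : K) (p q : {poly K}) (v : N s) :
  act (a *: p + q) v = a *: act p v + act q v.
Proof.
elim: s v => [|m s IH] /= v; first by rewrite [LHS]thinmx0 [RHS]thinmx0.
by rewrite IH linearP mulrDl -scalerAl.
Qed.

Lemma actM s (p q : {poly K}) (v : N s) : act (p * q) v = act p (act q v).
Proof. by elim: s v => [|m s IH] //= v; rewrite IH rmorphM mulrA. Qed.

Lemma act1 s (v : N s) : act 1 v = v.
Proof. by elim: s v => [|m s IH] //= [a w]; rewrite IH rmorph1 mul1r. Qed.

Lemma mulTE s (v : N s) : mulT s v = act 'X v.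
Proof.
pose aL := GRing.isLinear.Build _ _ _ _ (@act 'X s) (@act_linear 'X s).
pose f : {linear _ -> _} := HB.pack (@act 'X s) aL.
exact: (lfunE f).
Qed.

Lemma KT_homE s t (g : 'Hom(N s, N t)) :
  is_KT_hom g <-> (g \o mulT s = mulT t \o g)%VF.
Proof.
split=> [gh | gT]; first by apply/lfunP => v; rewrite !comp_lfunE !mulTE gh.
have gX v : g (act 'X v) = act 'X (g v).
  by move/lfunP/(_ v): gT; rewrite !comp_lfunE !mulTE.
have act0 r (w : N r) : act 0 w = 0.
  by rewrite -[X in act X w](subrr 1) addrC -scaleN1r act_poly_linear scaleN1r addNr.
elim/poly_ind => [|p c IH] v; first by rewrite !act0 linear0.
rewrite addrC -alg_polyC !act_poly_linear !act1 !actM linearP /=.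
by rewrite IH gX.
Qed.

Lemma endS_defect_linear Z : linear (@endS_defect Z).
Proof.
move=> a [u1 u2] [v1 v2]; rewrite /endS_defect /=.
congr (_, _, _); rewrite comp_lfunDl comp_lfunDr -comp_lfunZl -comp_lfunZr
  [RHS]/= scalerBr opprD addrACA //.
Qed.

Lemma mem_endS Z (g : 'End(N (alpha Z)) * 'End(N (beta Z))) :
  g \in endS Z <->
  exists h : morS Z Z, g = (mor1 h, mor2 h).
Proof.
pose dL := GRing.isLinear.Build _ _ _ _ (@endS_defect Z) (@endS_defect_linear Z).
pose f : {linear _ -> _} := HB.pack (@endS_defect Z) dL.
have fE : linfun (@endS_defect Z) g = endS_defect g by exact: (lfunE f).
rewrite memv_ker fE; case: g {fE} => g1 g2 /=.
split=> [/eqP[/subr0_eq/KT_homE h1 /subr0_eq/KT_homE h2 /subr0_eq h3]|].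
  by exists (MorS h1 h2 h3).
case=> [[k1 k2 /KT_homE h1 /KT_homE h2 h3]] [-> ->] /=.
by rewrite /endS_defect /= h1 h2 h3 !subrr.
Qed.

(* Existence and uniqueness up to isomorphism of the minimiser are facts about
   this property, not part of it; is_generic_extension Y X Z thus says that Z
   represents the isomorphism class Y * X. *)
Definition is_generic_extension (Y X Z : objS) : Prop :=
  is_extension Y X Z /\
  forall Z', is_extension Y X Z' -> (\dim (endS Z) <= \dim (endS Z'))%N.

End Category.

(* Main.v *)
Require Import Defs.
From HB Require Import structures.
From mathcomp Require Import all_boot all_order all_algebra.
From mathcomp Require Import qpoly zify.

Set Implicit Arguments.
Unset Strict Implicit.
Unset Printing Implicit Defensive.

Import GRing.Theory.
Local Open Scope ring_scope.

(** An object of S_1 amounts to a triple (V, T, U): the space V = N_beta, the action T of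
    the variable, and the image U of N_alpha; T is nilpotent and kills U, because
    N_alpha is semisimple.  Such a triple carries the increasing filtration
    K_0 = 0, K_1 = U, K_(n+2) = T^-1(K_n), called [fil] below.

    The indecomposable triples are the pickets P_l (l >= 1): a cyclic K[T]-module
    of dimension uphalf l, with U its socle if l is odd and 0 if l is even.  Every
    triple is a direct sum of pickets ([picket_decomposition]).  A homomorphism
    P_l -> M is the choice of an element of K_l(M), so dim End(M) is the sum of
    dim K_l(M) over the lengths l of the pickets in M.

    Rigidity ([iso_of_fdim_edim]).  Let M and M' have the same dim V and the same
    dim U, and let dim K_n(M) <= dim K_n(M') for all n.  Then
    dim End(M) <= dim End(M'), with equality only if M and M' are isomorphic.
    Indeed dim Hom(M, M) <= dim Hom(M, M') <= dim Hom(M', M'): the first step is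
    clear from the formula above, and the second follows from a duality that
    expresses dim Hom(M, P_j) through dim K_(j+1)(M).  Equality in the second step
    forces all the dimensions of the filtrations to agree, hence the multiplicities
    of the pickets.

    Extensions are linear data ([extension_glue], [glue_extension]).  The
    extensions of B by A are the triples on A + B with subspace U_A + U_B and
    operator (a, b) |-> (T a + C b, T b), where C : B -> A is any linear map that
    vanishes on U_B.  On a line of such operators each dim K_n takes its smallest
    value at all but finitely many points ([generic_fdim]), since the rank of a
    matrix of polynomials can only drop where some fixed minor vanishes.

    Associativity.  Both iterated extensions L and R live on Z + Y + X with the
    same U, and their operators agree on the graded pieces.  Join the two operators
    by a line and take a general point W of it.  Then all dim K_n of W are at most
    those of L and of R; for the subobject of W on Z + Y they are at most those of
    Y * Z, and for the quotient of W on Y + X at most those of X * Y.  By rigidity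
    and the minimality of Y * Z and X * Y, the subobject is Y * Z and the quotient
    is X * Y.  So W is an extension of X by Y * Z and also one of X * Y by Z;
    rigidity and the minimality of L and R now give L = W = R. *)

(** * Linear maps and products of vector spaces *)

Section LinearAlgebra.

Variable K : fieldType.
Implicit Types U V W : vectType K.

Lemma linfunE V W (f : V -> W) : linear f -> linfun f =1 f.
Proof.
move=> lf v; pose fL := GRing.isLinear.Build _ _ _ _ f lf.
pose g : {linear _ -> _} := HB.pack f fL.
exact: (lfunE g).
Qed.

Definition prodv V W (A : {vspace V}) (B : {vspace W}) : {vspace (V * W)%type} :=
  ((linfun fst @^-1: A) :&: (linfun snd @^-1: B))%VS.

Lemma mem_prodv V W (A : {vspace V}) (B : {vspace W}) x :
  (x \in prodv A B) = (x.1 \in A) && (x.2 \in B).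
Proof. by rewrite memv_cap -!memv_preim !linfunE. Qed.

(** Subspaces given by conditions rather than by bases are compared through explicit
    maps; two such maps in opposite directions give an equality of dimensions. *)
Lemma dimv_leq_inj V W (A : {vspace V}) (B : {vspace W}) (f : V -> W) :
  linear f -> {in A, forall v, f v \in B} ->
  {in A, forall v, f v = 0 -> v = 0} -> (\dim A <= \dim B)%N.
Proof.
move=> lf fAB f0; rewrite -(@limg_dim_eq _ _ _ (linfun f) A).
  by apply/dimvS/subvP=> _ /memv_imgP[v Av ->]; rewrite linfunE ?fAB.
apply/eqP; rewrite -subv0; apply/subvP=> v; rewrite memv_cap memv_ker linfunE //.
by case/andP=> Av /eqP/(f0 v Av)->; rewrite mem0v.
Qed.

Lemma dim_prodv V W (A : {vspace V}) (B : {vspace W}) :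
  \dim (prodv A B) = (\dim A + \dim B)%N.
Proof.
pose i : 'Hom(V, (V * W)%type) := linfun (fun v : V => (v, 0 : W)).
pose j : 'Hom(W, (V * W)%type) := linfun (fun w : W => (0 : V, w)).
have iE v : i v = (v, 0).
  by rewrite linfunE // => a x y; congr (_, _); rewrite /= scaler0 addr0.
have jE w : j w = (0, w).
  by rewrite linfunE // => a x y; congr (_, _); rewrite /= scaler0 addr0.
have -> : prodv A B = (i @: A + j @: B)%VS.
  apply/vspaceP=> -[v w]; rewrite mem_prodv; apply/andP/memv_addP => /=.
    case=> Av Bw; exists (i v); first exact: memv_img.
    exists (j w); first exact: memv_img.
    by rewrite iE jE; congr (_, _); rewrite ?addr0 ?add0r.
  case=> _ /memv_imgP[a Aa ->] [_ /memv_imgP[b Bb ->]]; rewrite iE jE.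
  by case=> -> ->; rewrite addr0 add0r.
rewrite dimv_disjoint_sum; last first.
  apply/eqP; rewrite -subv0; apply/subvP=> v; rewrite memv_cap memv0.
  case/andP=> /memv_imgP[a Aa ->] /memv_imgP[b Bb]; rewrite iE jE.
  by case=> -> _.
congr (_ + _)%N; apply: limg_dim_eq; apply/eqP; rewrite -subv0; apply/subvP=> v.
  by rewrite memv_cap memv_ker iE memv0 => /andP[_ /eqP[->]].
by rewrite memv_cap memv_ker jE memv0 => /andP[_ /eqP[->]].
Qed.

Lemma functional_off V (A : {vspace V}) (w : V) : w \notin A ->
  exists phi : V -> K, [/\ scalar phi, {in A, forall v, phi v = 0} & phi w = 1].
Proof.
move=> wA; pose p v := v - projv A v.
have pL a u v : p (a *: u + v) = a *: p u + p v.
  by rewrite /p linearP scalerBr opprD addrACA.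
have pA v : v \in A -> p v = 0 by move=> vA; rewrite /p projv_id ?subrr.
have pw0 : p w != 0.
  by apply: contra wA; rewrite subr_eq0 => /eqP->; rewrite memv_proj.
have [i ci] : exists i, coord (vbasis fullv) i (p w) != 0.
  apply/existsP; apply: contraNT pw0; rewrite negb_exists => /forallP c0.
  rewrite (coord_vbasis (memvf (p w))) big1 // => i _.
  by move/negPn/eqP: (c0 i) => ->; rewrite scale0r.
exists (fun v => (coord (vbasis fullv) i (p w))^-1 * coord (vbasis fullv) i (p v)).
split=> [a u v | v vA|].
- by rewrite pL linearP /= mulrDr mulrCA.
- by rewrite (pA v vA) raddf0 mulr0.
- by rewrite mulVf.
Qed.

End LinearAlgebra.

(** * Triples *)

Section Triples.

Variable K : fieldType.

(** The filtration interleaves the kernels of the powers of T with the preimages of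
    U under these powers; see [mem_fil_even] and [mem_fil_odd].  In terms of the
    maps V -> V/U -> V induced by T, the n-th step is the set of vectors of V that
    are killed by n alternate applications of the two maps. *)
Fixpoint filt (V : vectType K) (T : 'End(V)) (U : {vspace V}) n : {vspace V} :=
  match n with
  | 0 => 0%VS
  | 1 => U
  | n'.+2 => (T @^-1: filt T U n')%VS
  end.

Record triple := Triple {
  carrier : vectType K;
  op : 'End(carrier);
  sub : {vspace carrier}
}.
Implicit Types M N P : triple.

Definition fil M n := filt (op M) (sub M) n.
Definition fdim M n := \dim (fil M n).

Definition admissible M :=
  (forall u, u \in sub M -> op M u = 0) /\
  (exists n, forall v, iter n (op M) v = 0).

Definition is_hom M N (f : 'Hom(carrier M, carrier N)) :=
  (forall v, f (op M v) = op N (f v)) /\ {in sub M, forall u, f u \in sub N}.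

Definition iso M N := exists f g,
  [/\ @is_hom M N f, @is_hom N M g, cancel f g & cancel g f].

Lemma hom_id M : @is_hom M M (@id_lfun K (carrier M)).
Proof. by split=> [v|u uM]; rewrite !id_lfunE. Qed.

Lemma hom_comp M N P f g : @is_hom M N f -> @is_hom N P g -> @is_hom M P (g \o f)%VF.
Proof.
move=> [fT fU] [gT gU]; split=> [v|u uM]; rewrite !comp_lfunE ?fT ?gT //.
exact/gU/fU.
Qed.

Lemma iso_refl M : iso M M.
Proof.
exists (@id_lfun K (carrier M)), (@id_lfun K (carrier M)).
by split=> [||v|v]; rewrite ?id_lfunE //; apply: hom_id.
Qed.

Lemma iso_sym M N : iso M N -> iso N M.
Proof. by case=> f [g [hf hg fK gK]]; exists g, f. Qed.

Lemma iso_trans M N P : iso M N -> iso N P -> iso M P.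
Proof.
case=> f [g [hf hg fK gK]] [f' [g' [hf' hg' fK' gK']]].
exists (f' \o f)%VF, (g \o g')%VF; split; try exact: hom_comp.
  by move=> v; rewrite !comp_lfunE fK' fK.
by move=> v; rewrite !comp_lfunE gK gK'.
Qed.

Lemma iter_linear0 (V : vectType K) (T : 'End(V)) n : iter n T 0 = 0 :> V.
Proof. by elim: n => //= n ->; rewrite linear0. Qed.

Lemma hom_iter M N f : @is_hom M N f -> forall n v, f (iter n (op M) v) = iter n (op N) (f v).
Proof. by case=> fT _; elim=> //= n IH v; rewrite fT IH. Qed.

Lemma admissible_iso M N : iso M N -> admissible M -> admissible N.
Proof.
case=> f [g [hf hg fK gK]] [MU [n Mn]]; split=> [u uN|].
  by rewrite -[op N u]gK (proj1 hg) MU ?linear0 //; apply: (proj2 hg).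
by exists n => v; rewrite -[v]gK -(hom_iter hf) Mn linear0.
Qed.

Lemma mem_filSS M n v : (v \in fil M n.+2) = (op M v \in fil M n).
Proof. by rewrite memv_preim. Qed.

(** The filtration is functorial; this is why it bounds the images of generators of
    pickets. *)
Lemma hom_fil M N f n : @is_hom M N f -> {in fil M n, forall v, f v \in fil N n}.
Proof.
case=> fT fU; elim/ltn_ind: n => -[|[|n]] IH v.
- by rewrite !memv0 => /eqP->; rewrite linear0.
- exact: fU.
- by rewrite !mem_filSS -fT; apply: IH.
Qed.

Lemma lfun_linear (V W : vectType K) (f : 'Hom(V, W)) : linear f.
Proof. by move=> a u v; rewrite linearP. Qed.

Lemma fdim_iso M N n : iso M N -> fdim M n = fdim N n.
Proof.
suff le M' N' : iso M' N' -> (fdim M' n <= fdim N' n)%N.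
  by move=> MN; apply/eqP; rewrite eqn_leq !le //; apply: iso_sym.
case=> f [g [hf hg fK gK]]; apply: (dimv_leq_inj (lfun_linear f)).
  exact: hom_fil.
by move=> v _ fv0; rewrite -[v]fK fv0 linear0.
Qed.

Lemma mem_fil_even M n v : (v \in fil M n.*2) = (iter n (op M) v == 0).
Proof.
by elim: n v => [|n IH] v; rewrite ?memv0 // doubleS mem_filSS IH -iterSr.
Qed.

Lemma mem_fil_odd M n v : (v \in fil M n.*2.+1) = (iter n (op M) v \in sub M).
Proof. by elim: n v => [|n IH] v //; rewrite doubleS mem_filSS IH -iterSr. Qed.

Lemma mem_fil_iter M n m v : (v \in fil M (n + m.*2)) = (iter m (op M) v \in fil M n).
Proof.
elim: m v => [|m IH] v; first by rewrite addn0.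
by rewrite doubleS !addnS mem_filSS IH -iterSr.
Qed.

Lemma filS M n : admissible M -> (fil M n <= fil M n.+1)%VS.
Proof.
move=> [MU _]; elim/ltn_ind: n => -[|[|n]] IH; first exact: sub0v.
  by apply/subvP=> u uM; rewrite mem_filSS MU ?mem0v.
apply/subvP=> v; rewrite !mem_filSS; apply/subvP; exact: IH.
Qed.

Lemma fil_leq M m n : admissible M -> (m <= n)%N -> (fil M m <= fil M n)%VS.
Proof.
move=> gM /subnK<-; elim: (n - m)%N => //= k IH.
by rewrite addSn (subv_trans IH) ?filS.
Qed.

Lemma fil_full M : admissible M -> exists n, fil M n = fullv.
Proof.
case=> _ [n Mn]; exists n.*2; apply/vspaceP=> v.
by rewrite mem_fil_even Mn eqxx memvf.
Qed.

Definition dsum M N := Triple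
  (linfun (fun x : carrier M * carrier N => (op M x.1, op N x.2)))
  (prodv (sub M) (sub N)).

Lemma op_dsum M N x : op (dsum M N) x = (op M x.1, op N x.2).
Proof. by rewrite linfunE // => a u v; congr (_, _); rewrite /= linearP. Qed.

Lemma mem_fil_dsum M N n x :
  (x \in fil (dsum M N) n) = (x.1 \in fil M n) && (x.2 \in fil N n).
Proof.
elim/ltn_ind: n x => -[|[|n]] IH x; last first.
- by rewrite !mem_filSS op_dsum IH.
- by rewrite mem_prodv.
- by rewrite !memv0; case: x.
Qed.

Lemma fil_dsum M N n : fil (dsum M N) n = prodv (fil M n) (fil N n).
Proof. by apply/vspaceP=> x; rewrite mem_fil_dsum mem_prodv. Qed.

Lemma fdim_dsum M N n : fdim (dsum M N) n = (fdim M n + fdim N n)%N.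
Proof. by rewrite /fdim fil_dsum dim_prodv. Qed.

Lemma iso_dsumr P M N : iso M N -> iso (dsum P M) (dsum P N).
Proof.
case=> f [g [hf hg fK gK]].
have lin M1 N1 (h : 'Hom(carrier M1, carrier N1)) :
    linear (fun x : carrier P * carrier M1 => (x.1, h x.2)).
  by move=> a u v; congr (_, _); rewrite /= linearP.
have hom M1 N1 h : @is_hom M1 N1 h ->
    @is_hom (dsum P M1) (dsum P N1) (linfun (fun x : carrier P * carrier M1 => (x.1, h x.2))).
  case=> hT hU; split=> [x|x]; first by rewrite !op_dsum !(linfunE (lin _ _ h)) /= hT.
  by rewrite !mem_prodv (linfunE (lin _ _ h)) /= => /andP[-> /hU].
exists (linfun (fun x : carrier P * carrier M => (x.1, f x.2))).
exists (linfun (fun x : carrier P * carrier N => (x.1, g x.2))).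
split; try exact: hom.
  by move=> [x y]; rewrite !(linfunE (lin _ _ _)) /= fK.
by move=> [x y]; rewrite !(linfunE (lin _ _ _)) /= gK.
Qed.

End Triples.

(** * Multiplication by the variable on truncated polynomials *)

Section TruncatedPolynomials.

Variables (K : fieldType) (m : nat).
Hypothesis m_gt0 : (0 < m)%N.
Local Notation Q := {poly %/ ('X^m : {poly K})}.
Implicit Types a b : Q.

Lemma size_truncated : (size (mk_monic ('X^m : {poly K}))).-1 = m.
Proof. by rewrite mk_monic_Xn size_polyXn /=; case: m m_gt0. Qed.

Lemma coef_truncated_out a i : (m <= i)%N -> a`_i = 0.
Proof. by rewrite -[X in (X <= _)%N]size_truncated; apply: big_coef_npoly. Qed.

Lemma truncatedP a b : (forall i, (i < m)%N -> a`_i = b`_i) -> a = b.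
Proof.
move=> ab; apply/npolyP=> i; have [im|mi] := ltnP i m; first exact: ab.
by rewrite !coef_truncated_out.
Qed.

Lemma coef_mk_truncated (E : nat -> K) i :
  (mk_npoly _ E : Q)`_i = if (i < m)%N then E i else 0.
Proof. by rewrite coef_poly size_truncated. Qed.

Lemma coef_in_truncated (p : {poly K}) i :
  (in_qpoly 'X^m p)`_i = if (i < m)%N then p`_i else 0.
Proof.
rewrite /= mk_monic_Xn prednK // -Pdiv.IdomainMonic.modpE ?monicXn //.
by rewrite -Pdiv.IdomainMonic.take_poly_modp coef_poly.
Qed.

Lemma in_truncated_val a : in_qpoly 'X^m (val a) = a.
Proof. by apply: truncatedP => i im; rewrite coef_in_truncated im. Qed.

Lemma coef_mulX_truncated a i :
  (in_qpoly 'X^m 'X * a : Q)`_i = if (0 < i < m)%N then a`_i.-1 else 0.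
Proof.
rewrite -{1}[a]in_truncated_val -rmorphM coef_in_truncated coefXM.
by case: i => [|i] /=; [case: ifP | ].
Qed.

Lemma coef_one_truncated i : (1 : Q)`_i = (i == 0%N)%:R.
Proof.
rewrite -(rmorph1 (in_qpoly 'X^m)) coef_in_truncated coef1.
by case: i => [|i]; rewrite ?m_gt0 // if_same.
Qed.

Definition shift : 'End(Q) := linfun (fun a : Q => in_qpoly 'X^m 'X * a).

Lemma shiftE a : shift a = in_qpoly 'X^m 'X * a.
Proof. by rewrite linfunE // => c u v; rewrite mulrDr -scalerAr. Qed.

Lemma coef_shift a i : (shift a)`_i = if (0 < i < m)%N then a`_i.-1 else 0.
Proof. by rewrite shiftE coef_mulX_truncated. Qed.

Lemma coef_iter_shift a j i :
  (iter j shift a)`_i = if (j <= i < m)%N then a`_(i - j) else 0.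
Proof.
elim: j i => [|j IH] i /=.
  by rewrite subn0; case: ltnP => // /coef_truncated_out.
rewrite coef_shift IH; case: i => [|i] //=; rewrite subSS ltnS.
by case: ltnP => im; rewrite ?andbF // (ltnW im) andbT.
Qed.

Lemma truncated_sum a : a = \sum_(j < m) a`_j *: iter j shift 1.
Proof.
apply: truncatedP => i im; rewrite coefn_sum (bigD1 (Ordinal im)) //= big1 => [|j].
  by rewrite coefZ coef_iter_shift leqnn im subnn coef_one_truncated eqxx mulr1 addr0.
rewrite -val_eqE /= => ji; rewrite coefZ coef_iter_shift im andbT coef_one_truncated.
by case: leqP => [le_ji|_]; rewrite ?mulr0 // subn_eq0 leqNgt ltn_neqAle ji le_ji mulr0.
Qed.

End TruncatedPolynomials.

(** * Pickets *)

Section Cyclic.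

Variable K : fieldType.
Implicit Types M N : triple K.

(** The length l counts the composition factors of V and of V/U together: the
    picket is a single chain under V -> V/U -> V -> V/U -> ..., starting in V and
    ending in V exactly when l is odd, in which case the last vector lies in U. *)
Definition picket l : triple K :=
  @Triple K {poly %/ ('X^(uphalf l) : {poly K})} (shift K (uphalf l))
    (if odd l then lker (shift K (uphalf l)) else 0%VS).

(** The filtration of a picket consists of the powers of the ideal generated by
    the variable, as a picket is uniserial. *)
Lemma mem_fil_picket l n (a : carrier (picket l)) : (0 < l)%N ->
  reflect (forall i, (i < uphalf (l - n))%N ->
    (a : {poly %/ ('X^(uphalf l) : {poly K})})`_i = 0) (a \in fil (picket l) n).
Proof.
move=> l_gt0; have m_gt0 : (0 < uphalf l)%N by lia.
have sh := coef_shift m_gt0.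
elim/ltn_ind: n a => -[|[|n]] IH a.
- rewrite memv0 subn0; apply: (iffP eqP) => [-> i _|a0]; first by rewrite coef0.
  by apply: truncatedP => // i im; rewrite a0 ?coef0.
- rewrite subn1; case l_odd: (odd l); last first.
    rewrite [_ \in _](_ : _ = (a == 0)) ?/fil /= ?l_odd ?memv0 //.
    rewrite (_ : uphalf l.-1 = uphalf l); last by lia.
    apply: (iffP eqP) => [-> i _|a0]; first by rewrite coef0.
    by apply: truncatedP => // i im; rewrite a0 ?coef0.
  rewrite [_ \in _](_ : _ = (shift K (uphalf l) a == 0)); last first.
    by rewrite /fil /= l_odd memv_ker.
  apply: (iffP eqP) => [a0 i im|a0].
    have /(congr1 (fun b : {poly %/ ('X^(uphalf l) : {poly K})} => b`_i.+1)) := a0.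
    by rewrite sh coef0 /= ifT //; lia.
  apply: truncatedP => // i im; rewrite sh coef0; case: ifP => // ?.
  by apply: a0; lia.
- rewrite mem_filSS; apply: (iffP (IH n _ _)) => [//||] a0 i im.
    have := a0 i.+1; rewrite sh /= ifT; last by lia.
    by apply; lia.
  rewrite sh; case: ifP => // ?; apply: a0; lia.
Qed.

Arguments mem_fil_picket {l} n a _.

Lemma fdim_picket l n : (0 < l)%N -> fdim (picket l) n = (uphalf l - uphalf (l - n))%N.
Proof.
move=> l_gt0; have m_gt0 : (0 < uphalf l)%N by lia.
set m := uphalf l; set d := uphalf (l - n); have dm : (d <= m)%N by rewrite /d /m; lia.
apply/eqP; rewrite eqn_leq; apply/andP; split.
  rewrite -[X in (_ <= X)%N](dim_polyn K).
  apply: (dimv_leq_inj (f := fun a : {poly %/ ('X^m : {poly K})} =>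
    mk_npoly (m - d) (fun i => a`_(i + d)))).
  - move=> c u v; apply/npolyP=> i; rewrite coefD coefZ !coef_poly coefD coefZ.
    by case: ifP => //; rewrite mulr0 addr0.
  - by move=> a _; apply: memvf.
  move=> a /(mem_fil_picket _ _ l_gt0) a0 /npolyP sa0; apply: truncatedP => // i im.
  rewrite coef0; have [id|di] := ltnP i d; first exact: a0.
  by have := sa0 (i - d)%N; rewrite coef_poly coef0 subnK // ifT // ltn_sub2r //; lia.
rewrite -[X in (X <= _)%N](dim_polyn K).
apply: (dimv_leq_inj (f := fun b : {poly_(m - d) K} =>
  (mk_npoly _ (fun i => if (d <= i)%N then b`_(i - d) else 0)
   : {poly %/ ('X^m : {poly K})}))).
- move=> c u v; apply/npolyP=> i; rewrite coefD coefZ !coef_mk_truncated // coefD coefZ.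
  by case: (i < m)%N; case: (d <= i)%N; rewrite ?mulr0 ?addr0.
- move=> b _; apply/(mem_fil_picket _ _ l_gt0) => i im.
  by rewrite coef_mk_truncated // (leqNgt d) (im : (i < d)%N) if_same.
move=> b _ /npolyP b0; apply/npolyP=> i; rewrite coef0.
have [im|] := ltnP i (m - d); last exact: big_coef_npoly.
have := b0 (i + d)%N; rewrite coef_mk_truncated // coef0 leq_addl addnK ifT //; lia.
Qed.

(** This is p |-> p(T) v, written on the coefficients of the reduced polynomial, so
    that it makes sense, and is linear in v, for every v; it is a homomorphism only
    for v in the l-th step of the filtration. *)
Definition picket_map l N (v : carrier N) : 'Hom(carrier (picket l), carrier N) :=
  linfun (fun a : {poly %/ ('X^(uphalf l) : {poly K})} =>
    \sum_(j < uphalf l) a`_j *: iter j (op N) v).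

Lemma picket_mapE l N v (a : {poly %/ ('X^(uphalf l) : {poly K})}) :
  picket_map l v a = \sum_(j < uphalf l) a`_j *: iter j (op N) v.
Proof.
rewrite linfunE // => c u w; rewrite scaler_sumr -big_split; apply: eq_bigr => j _.
by rewrite coefD coefZ scalerDl scalerA.
Qed.

Lemma iter_linear (V : vectType K) (T : 'End(V)) n : linear (iter n T).
Proof. by elim: n => [|n IH] c u v //=; rewrite IH linearP. Qed.

Lemma picket_map_linear l N a : linear (fun v : carrier N => picket_map l v a).
Proof.
move=> c u v; rewrite !picket_mapE scaler_sumr -big_split; apply: eq_bigr => j _.
by rewrite iter_linear scalerDr !scalerA mulrC.
Qed.

Lemma picket_map1 l N (v : carrier N) : (0 < l)%N ->
  picket_map l v (1 : {poly %/ ('X^(uphalf l) : {poly K})}) = v.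
Proof.
move=> l_gt0; have m_gt0 : (0 < uphalf l)%N by lia.
rewrite picket_mapE (bigD1 (Ordinal m_gt0)) //= big1 => [|j].
  by rewrite (coef_one_truncated _ m_gt0) scale1r addr0.
by rewrite -val_eqE /= => /negPf j0; rewrite (coef_one_truncated _ m_gt0) j0 scale0r.
Qed.

Lemma sum_shift (V : vectType K) (c : nat -> K) (w : nat -> V) m : w m = 0 ->
  \sum_(j < m) (if (0 < j < m)%N then c j.-1 else 0) *: w j =
  \sum_(j < m) c j *: w j.+1.
Proof.
case: m => [|m] w0; first by rewrite !big_ord0.
rewrite big_ord_recl big_ord_recr /= scale0r add0r w0 scaler0 addr0.
by apply: eq_bigr => j _; rewrite /bump /= add1n ltnS ltn_ord.
Qed.

Lemma picket_map_hom l N (v : carrier N) : (0 < l)%N -> admissible N -> v \in fil N l ->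
  @is_hom K (picket l) N (picket_map l v).
Proof.
move=> l_gt0 gN vl; have m_gt0 : (0 < uphalf l)%N by lia.
have vm : iter (uphalf l) (op N) v = 0.
  apply/eqP; rewrite -mem_fil_even; apply: (subvP (fil_leq gN _)) vl; lia.
split=> [a|a].
  rewrite !picket_mapE linear_sum /=; under eq_bigr do rewrite coef_shift //.
  under [RHS]eq_bigr do rewrite linearZ.
  exact: (@sum_shift _ (fun j => (a : {poly K})`_j) (fun j => iter j (op N) v)).
rewrite -[sub _]/(fil (picket l) 1) => /(mem_fil_picket _ _ l_gt0) a0.
rewrite picket_mapE; apply: rpred_sum => j _.
have [jl|lj] := ltnP j (uphalf (l - 1)); first by rewrite a0 // scale0r mem0v.
apply: memvZ; rewrite -mem_fil_odd.
by rewrite (_ : j.*2.+1 = l) //; case: j lj => j /=; lia.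
Qed.

Lemma hom_picket l N f : (0 < l)%N -> @is_hom K (picket l) N f ->
  f =1 picket_map l (f (1 : {poly %/ ('X^(uphalf l) : {poly K})})).
Proof.
move=> l_gt0 hf a; have m_gt0 : (0 < uphalf l)%N by lia.
rewrite picket_mapE [in LHS](truncated_sum m_gt0 a) linear_sum; apply: eq_bigr => j _.
by rewrite linearZ /= -(hom_iter hf).
Qed.

Lemma one_in_fil_picket l : (0 < l)%N ->
  (1 : {poly %/ ('X^(uphalf l) : {poly K})}) \in fil (picket l) l.
Proof. by move=> l_gt0; apply/(mem_fil_picket _ _ l_gt0) => i; rewrite subnn. Qed.

End Cyclic.

(** * Spaces of homomorphisms *)

Section HomDimension.

Variable K : fieldType.
Implicit Types M N : triple K.

(** Linear equations for being a homomorphism: commutation with T, and vanishing of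
    the component outside of U of the restriction to U. *)
Definition hom_defect M N (f : 'Hom(carrier M, carrier N)) :
    'Hom(carrier M, carrier N) * 'Hom(carrier M, carrier N) :=
  ((f \o op M)%VF - (op N \o f)%VF,
   ((\1 - projv (sub N)) \o (f \o projv (sub M)))%VF).

Lemma hom_defect_linear M N : linear (@hom_defect M N).
Proof.
move=> a f g; rewrite /hom_defect /=; congr (_, _); apply/lfunP=> v.
  by rewrite /= !lfun_simp linearP /= scalerBr opprD addrACA.
by rewrite /= !lfun_simp linearP [X in _ - X]linearP /= scalerBr opprD addrACA.
Qed.

Definition homv M N : {vspace 'Hom(carrier M, carrier N)} := lker (linfun (@hom_defect M N)).

Lemma mem_homv M N f : reflect (@is_hom K M N f) (f \in homv M N).
Proof.
rewrite memv_ker linfunE; last exact: hom_defect_linear.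
apply: (iffP eqP) => [[/subr0_eq/lfunP fT /lfunP fU]|[fT fU]].
  split=> [v|u uM]; first by have:= fT v; rewrite !lfun_simp.
  have := fU u; rewrite !lfun_simp /= projv_id // => /subr0_eq->.
  exact: memv_proj.
congr (_, _); apply/lfunP=> v; rewrite !lfun_simp ?fT ?subrr //.
by rewrite [X in _ - X]projv_id ?subrr //; apply: fU; apply: memv_proj.
Qed.

Definition edim M := \dim (homv M M).

Lemma dim_homv_isol M M' N : iso M M' -> \dim (homv M N) = \dim (homv M' N).
Proof.
suff le M1 M2 : iso M1 M2 -> (\dim (homv M1 N) <= \dim (homv M2 N))%N.
  by move=> MM'; apply/eqP; rewrite eqn_leq !le //; apply: iso_sym.
case=> f [g [hf hg fK gK]].
apply: (dimv_leq_inj (f := fun h : 'Hom(carrier M1, carrier N) => (h \o g)%VF)).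
- by move=> a u v; rewrite comp_lfunDl comp_lfunZl.
- by move=> h /mem_homv hh; apply/mem_homv; apply: hom_comp hh.
move=> h _ /lfunP h0; apply/lfunP=> v; have := h0 (f v).
by rewrite comp_lfunE fK !zero_lfunE.
Qed.

Lemma dim_homv_isor M N N' : iso N N' -> \dim (homv M N) = \dim (homv M N').
Proof.
suff le N1 N2 : iso N1 N2 -> (\dim (homv M N1) <= \dim (homv M N2))%N.
  by move=> NN'; apply/eqP; rewrite eqn_leq !le //; apply: iso_sym.
case=> f [g [hf hg fK gK]].
apply: (dimv_leq_inj (f := fun h : 'Hom(carrier M, carrier N1) => (f \o h)%VF)).
- by move=> a u v; rewrite comp_lfunDr comp_lfunZr.
- by move=> h /mem_homv hh; apply/mem_homv; apply: hom_comp hh hf.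
move=> h _ /lfunP h0; apply/lfunP=> v; have := h0 v.
by rewrite comp_lfunE !zero_lfunE => fh0; rewrite -[h v]fK fh0 linear0.
Qed.

Lemma edim_iso M N : iso M N -> edim M = edim N.
Proof. by move=> MN; rewrite /edim (dim_homv_isol _ MN) (dim_homv_isor _ MN). Qed.

(** A homomorphism from a picket of length l is determined by the image of the
    generator 1, which can be any vector in the l-th step of the filtration. *)
Lemma dim_homv_picket l M N : (0 < l)%N -> admissible N ->
  \dim (homv (dsum (picket K l) M) N) = (fdim N l + \dim (homv M N))%N.
Proof.
move=> l_gt0 gN; rewrite -dim_prodv.
pose Q : vectType K := {poly %/ ('X^(uphalf l) : {poly K})}.
pose e : Q := (1 : {poly %/ ('X^(uphalf l) : {poly K})}).
have pairl : linear (fun y : carrier M => (0 : Q, y)).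
  by move=> a u v; congr (_, _); rewrite /= scaler0 addr0.
have pairr : linear (fun x : Q => (x, 0 : carrier M)).
  by move=> a u v; congr (_, _); rewrite /= scaler0 addr0.
have hpairr : @is_hom K (picket K l) (dsum (picket K l) M)
    (linfun (fun x : Q => (x, 0 : carrier M))).
  split=> [x|x]; first by rewrite op_dsum !(linfunE pairr) /= linear0.
  by rewrite mem_prodv (linfunE pairr) /= mem0v andbT.
have hpairl : @is_hom K M (dsum (picket K l) M)
    (linfun (fun y : carrier M => (0 : Q, y))).
  split=> [x|x]; first by rewrite op_dsum !(linfunE pairl) /= linear0.
  by rewrite mem_prodv (linfunE pairl) /= mem0v.
have lin v (h : 'Hom(carrier M, carrier N)) :
    linear (fun x : Q * carrier M => picket_map l v x.1 + h x.2).
  by move=> a x y; rewrite /= !linearP scalerDr addrACA.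
apply/eqP; rewrite eqn_leq; apply/andP; split.
  apply: (dimv_leq_inj (f := fun h : 'Hom(carrier (dsum (picket K l) M), carrier N) =>
    (h (e, 0), h \o linfun (fun y : carrier M => (0 : Q, y)))%VF)).
  - move=> a u v; congr (_, _); first by rewrite !lfun_simp.
    by apply/lfunP=> y; rewrite /= !lfun_simp.
  - move=> h /mem_homv hh; rewrite mem_prodv /=; apply/andP; split.
      apply: (hom_fil hh); rewrite mem_fil_dsum /= mem0v andbT.
      exact: one_in_fil_picket.
    exact/mem_homv/(hom_comp hpairl hh).
  move=> h /mem_homv hh [h1 /lfunP h2]; apply/lfunP=> -[x y].
  have -> : h (x, y) = h (x, 0) + h (0, y).
    by rewrite -linearD; congr (h (_, _)); rewrite /= ?addr0 ?add0r.
  have hx := hom_picket l_gt0 (hom_comp hpairr hh) x.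
  have hy := h2 y; rewrite comp_lfunE (linfunE pairl) zero_lfunE in hy.
  rewrite !comp_lfunE !(linfunE pairr) h1 picket_mapE big1 in hx.
    by rewrite hx hy zero_lfunE addr0.
  by move=> j _; rewrite iter_linear0 scaler0.
apply: (dimv_leq_inj (f := fun p : carrier N * 'Hom(carrier M, carrier N) =>
  linfun (fun x : Q * carrier M => picket_map l p.1 x.1 + p.2 x.2))).
- move=> a [u g] [v h]; apply/lfunP => x.
  rewrite /= !lfun_simp !(linfunE (lin _ _)) /= picket_map_linear !lfun_simp.
  by rewrite scalerDr addrACA.
- move=> [v h]; rewrite mem_prodv /= => /andP[vl /mem_homv [hT hU]].
  have [gT gU] := picket_map_hom l_gt0 gN vl.
  apply/(@mem_homv (dsum (picket K l) M) N); split=> [x|x].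
    by rewrite op_dsum !(linfunE (lin _ _)) /= gT hT linearD.
  rewrite mem_prodv (linfunE (lin _ _)) /= => /andP[x1 x2].
  by rewrite memvD //; [apply: gU | apply: hU].
move=> [v h] _ /lfunP p0; congr (_, _).
  have := p0 (e, 0); rewrite (linfunE (lin _ _)) /= picket_map1 // linear0 addr0 => ->.
  by rewrite zero_lfunE.
apply/lfunP=> y; have := p0 (0, y); rewrite (linfunE (lin _ _)) /= linear0 add0r => ->.
by rewrite !zero_lfunE.
Qed.

Definition zero_triple : triple K := @Triple K 'rV[K]_0 0 0%VS.

Fixpoint picket_sum (ls : seq nat) : triple K :=
  if ls is l :: ls' then dsum (picket K l) (picket_sum ls') else zero_triple.

Lemma dim_homv_picket_sum ls N : all (leq 1) ls -> admissible N ->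
  \dim (homv (picket_sum ls) N) = (\sum_(l <- ls) fdim N l)%N.
Proof.
move=> + gN; elim: ls => [_|l ls IH /= /andP[l_gt0 ls_gt0]]; last first.
  by rewrite dim_homv_picket // big_cons IH.
rewrite big_nil; apply/eqP; rewrite dimv_eq0 -subv0; apply/subvP=> f _.
by rewrite memv0; apply/eqP/lfunP=> v; rewrite [v]thinmx0 !linear0.
Qed.

Lemma fdim_picket_sum ls n : all (leq 1) ls ->
  fdim (picket_sum ls) n = (\sum_(l <- ls) (uphalf l - uphalf (l - n)))%N.
Proof.
elim: ls => [_|l ls IH /= /andP[l_gt0 ls_gt0]]; last first.
  by rewrite fdim_dsum fdim_picket // big_cons IH.
rewrite big_nil; apply/eqP; rewrite dimv_eq0 -subv0; apply/subvP=> v _.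
by rewrite memv0 [v]thinmx0.
Qed.

End HomDimension.

(** * Decomposition into pickets *)

Section Decomposition.

Variable K : fieldType.
Implicit Types M N P : triple K.

(** The complement of the retract P is the kernel of the retraction. *)
Lemma retract_summand P M g r : @is_hom K P M g -> @is_hom K M P r -> cancel g r ->
  exists M', iso M (dsum P M').
Proof.
move=> [gT gU] [rT rU] gK; pose W := lker r.
have Wop w : w \in W -> op M w \in W.
  by rewrite !memv_ker rT => /eqP->; rewrite linear0.
have proj_lin : linear (fun w : subvs_of W => vsproj W (op M (vsval w))).
  by move=> a u v; rewrite !linearP.
have val_lin : linear (fun w : subvs_of W => vsval w) by [].
pose M' := Triple (linfun (fun w : subvs_of W => vsproj W (op M (vsval w))))
  ((linfun (fun w : subvs_of W => vsval w) @^-1: sub M)%VS).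
have opM' (w : subvs_of W) : vsval (op M' w) = op M (vsval w).
  by rewrite (linfunE proj_lin) vsprojK // Wop ?subvsP.
have subM' (w : subvs_of W) : (w \in sub M') = (vsval w \in sub M).
  by rewrite -memv_preim (linfunE val_lin).
have cW x : x - g (r x) \in W by rewrite memv_ker linearB /= gK subrr.
have f_lin : linear (fun x => (r x, vsproj W (x - g (r x)))).
  move=> a u v; congr (_, _) => /=; first by rewrite linearP.
  have -> : a *: u + v - g (r (a *: u + v)) = a *: (u - g (r u)) + (v - g (r v)).
    by rewrite !linearP scalerDr addrACA.
  by rewrite linearP.
have b_lin : linear (fun x : carrier P * subvs_of W => g x.1 + vsval x.2).
  by move=> a u v; rewrite /= !linearP scalerDr addrACA.
exists M'; exists (linfun (fun x => (r x, vsproj W (x - g (r x))))).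
exists (linfun (fun x : carrier P * subvs_of W => g x.1 + vsval x.2)).
split.
- split=> [x|u uM].
    rewrite op_dsum !(linfunE f_lin) rT; congr (_, _); apply: subvs_inj.
    by rewrite opM' !vsprojK //= ?linearB ?gT // -gT -rT cW.
  by rewrite mem_prodv (linfunE f_lin) /= rU //= subM' vsprojK // memvB // gU // rU.
- split=> [x|u].
    by rewrite op_dsum !(linfunE b_lin) /= opM' gT linearD.
  by rewrite mem_prodv (linfunE b_lin) subM' => /andP[u1 u2]; rewrite memvD // gU.
- by move=> x; rewrite (linfunE b_lin) (linfunE f_lin) /= vsprojK // addrC subrK.
- move=> [x w]; rewrite (linfunE f_lin) (linfunE b_lin) /= linearD /= gK.
  have /eqP -> : r (vsval w) == 0 by rewrite -memv_ker subvsP.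
  by rewrite addr0 [g x + _]addrC addrK vsvalK.
Qed.

(** A picket of maximal length splits off.  With m = uphalf l, let phi be a
    functional that is 1 on T^(m-1) v and, for l even, vanishes on U; it exists
    since v is not in the step l - 1 of the filtration.  Then
    x |-> \sum_j phi (T^(m-1-j) x) X^j is a homomorphism to the picket, and its
    composite with the picket map of v is triangular with 1 on the diagonal, hence
    invertible. *)
Lemma picket_retract M l v :
  admissible M -> (0 < l)%N -> fil M l = fullv -> v \notin fil M l.-1 ->
  exists g r, [/\ @is_hom K (picket K l) M g, @is_hom K M (picket K l) r & cancel g r].
Proof.
move=> gM l_gt0 full vM; set m := uphalf l; have m_gt0 : (0 < m)%N by rewrite /m; lia.
pose Q : vectType K := {poly %/ ('X^m : {poly K})}.
pose T := op M.
have iterM i x : (m <= i)%N -> iter i T x = 0.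
  move=> mi; apply/eqP; rewrite -mem_fil_even.
  by apply: (subvP (fil_leq gM (_ : (l <= _)%N))); rewrite ?full ?memvf // /m in mi *; lia.
have wM : iter m.-1 T v \notin fil M (~~ odd l).
  apply: contra vM; rewrite -mem_fil_iter; congr (_ \in fil M _).
  by rewrite /m; lia.
have [phi [phiL phi0 phi1]] := functional_off wM.
have phi00 : phi 0 = 0 by apply: phi0; rewrite mem0v.
pose p x : {poly %/ ('X^m : {poly K})} := mk_npoly _ (fun j => phi (iter (m.-1 - j) T x)).
have pE x j : (j < m)%N -> (p x)`_j = phi (iter (m.-1 - j) T x).
  by move=> jm; rewrite coef_mk_truncated // jm.
have pL : linear p.
  move=> a x y; apply: truncatedP => // j jm.
  by rewrite coefD coefZ !pE // iter_linear phiL.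
have hp : @is_hom K M (picket K l) (linfun p).
  split=> [x|u uM]; rewrite !(linfunE pL).
    apply: truncatedP => // j jm; rewrite pE // [RHS]coef_shift // jm -iterSr.
    case: j jm => [|j] jm; first by rewrite subn0 prednK // iterM.
    by rewrite subnSK /= ?pE ?(ltnW jm) //; lia.
  apply/(@mem_fil_picket _ l 1 _ l_gt0) => j jl; rewrite pE; last by rewrite /m; lia.
  case E: (m.-1 - j)%N => [|k] /=; last first.
    by rewrite -iterS iterSr (proj1 gM) // iter_linear0.
  by apply: phi0; rewrite (_ : ~~ odd l = 1%N :> nat) //; rewrite /m in E *; lia.
have hg : @is_hom K (picket K l) M (picket_map l v) by apply: picket_map_hom; rewrite ?full ?memvf.
have hh := hom_comp hg hp; set h := (_ \o _)%VF in hh.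
(* Triangularity: coefficient j of h a involves only the coefficients of a up to j. *)
have tri (a : {poly %/ ('X^m : {poly K})}) d : (d <= m)%N ->
    (forall j, (j < d)%N -> (h a : {poly %/ ('X^m : {poly K})})`_j = 0) ->
    forall j, (j < d)%N -> a`_j = 0.
  move=> dm ha0; elim/ltn_ind => j IH jd; have jm := leq_trans jd dm.
  have := ha0 j jd; rewrite comp_lfunE (linfunE pL) pE // picket_mapE.
  have iterS x y : iter (m.-1 - j) T (x + y) = iter (m.-1 - j) T x + iter (m.-1 - j) T y.
    by have := iter_linear T (m.-1 - j) 1 x y; rewrite !scale1r.
  have phiS x y : phi (x + y) = phi x + phi y.
    by have := phiL 1 x y; rewrite scale1r mul1r.
  rewrite (big_morph _ iterS (iter_linear0 _ _)) (big_morph _ phiS phi00).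
  have iterZ c x : iter (m.-1 - j) T (c *: x) = c *: iter (m.-1 - j) T x.
    by have := iter_linear T (m.-1 - j) c x 0; rewrite iter_linear0 !addr0.
  have phiZ c x : phi (c *: x) = c * phi x.
    by have := phiL c x 0; rewrite phi00 !addr0.
  rewrite (bigD1 (Ordinal jm)) //= big1 => [|i]; last first.
    rewrite -val_eqE /= iterZ phiZ -iterD neq_ltn => /orP[ij|ji].
      by rewrite IH ?mul0r //; apply: ltn_trans jd.
    by rewrite iterM ?phi00 ?mulr0 //; move: (val i) jm ji => k; clear; lia.
  by rewrite addr0 iterZ phiZ -iterD subnK ?phi1 ?mulr1 //; lia.
have h0 : lker h == 0%VS.
  rewrite -subv0; apply/subvP=> a; rewrite memv_ker memv0 => /eqP ha0.
  by apply/eqP/truncatedP => // j jm; rewrite coef0 (tri a m) // => i _; rewrite ha0 coef0.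
have hK := lker0_lfunK h0; have hVK := lker0_lfunVK h0.
have hV : @is_hom K (picket K l) (picket K l) (h^-1)%VF.
  split=> [a|a aU]; first by rewrite -[a in LHS]hVK -(proj1 hh) hK.
  apply/(@mem_fil_picket _ l 1 _ l_gt0) => j jl; apply: (tri _ (uphalf (l - 1))) => //.
    by rewrite /m; lia.
  by move=> i il; rewrite hVK; apply: (@mem_fil_picket _ l 1 _ l_gt0 aU).
exists (picket_map l v), (h^-1 \o linfun p)%VF; split=> //; first exact: hom_comp hV.
by move=> a; rewrite comp_lfunE -[linfun p _]comp_lfunE hK.
Qed.

Lemma iter_op_dsum M N n x : iter n (op (dsum M N)) x = (iter n (op M) x.1, iter n (op N) x.2).
Proof. by elim: n => [|n IH]; rewrite /= -?surjective_pairing // IH op_dsum. Qed.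

Lemma admissible_dsumr P M : admissible (dsum P M) -> admissible M.
Proof.
case=> PU [n Pn]; split=> [u uM|].
  have := PU (0, u); rewrite mem_prodv /= mem0v uM op_dsum /= => /(_ isT).
  by case.
by exists n => x; have := Pn (0, x); rewrite iter_op_dsum; case.
Qed.

(** The longest picket is split off first, so that the lengths come out in
    decreasing order: the list is then determined by its multiset, and the list of
    the uphalf l is a partition. *)
Lemma picket_decomposition M : admissible M ->
  exists ls, [/\ sorted geq ls, all (leq 1) ls & iso M (picket_sum K ls)].
Proof.
move=> gM; have [l0 full] := fil_full gM.
suff main n : forall N l, admissible N -> fil N l = fullv -> (fdim N l <= n)%N ->
    exists ls, [/\ path geq l ls, all (leq 1) ls & iso N (picket_sum K ls)].
  have [ls [ls_sorted ls_gt0 isoM]] := main (fdim M l0) M l0 gM full (leqnn _).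
  by exists ls; split=> //; apply: path_sorted ls_sorted.
have trivial N l : fullv = 0%VS :> {vspace carrier N} ->
    exists ls, [/\ path geq l ls, all (leq 1) ls & iso N (picket_sum K ls)].
  move=> V0; have N0 (v : carrier N) : v = 0.
    by apply/eqP; rewrite -memv0 -V0 memvf.
  exists [::]; split=> //; exists 0, 0; split=> [||v|v].
  - by split=> [v|v _]; rewrite !zero_lfunE ?linear0 ?mem0v.
  - by split=> [v|v _]; rewrite !zero_lfunE ?linear0 ?mem0v.
  - by rewrite [v]N0 !linear0.
  - by rewrite [v]thinmx0 !linear0.
elim: n => [|n IH] N l gN fullN dimN.
  by apply/trivial/eqP; rewrite -dimv_eq0 -fullN -leqn0.
have exl : exists k, fil N k == fullv by exists l; rewrite fullN.
case: (ex_minnP exl) => -[|k] /eqP fullk mink; first exact: trivial.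
have [v _ vk] : exists2 v, v \in fullv & v \notin fil N k.
  apply/subvPn/negP => full_sub; have := mink k.
  by rewrite ltnn eqEsubv subvf full_sub => /(_ isT).
have [g [r [hg hr gK]]] := picket_retract gN (ltn0Sn k) fullk vk.
have [M' isoN] := retract_summand hg hr gK.
have full' : fil M' k.+1 = fullv.
  case: isoN => f [f' [hf hf' fK f'K]]; apply/vspaceP => x; rewrite memvf.
  have /(_ (f' (0, x))) := @hom_fil _ _ _ _ k.+1 hf.
  by rewrite fullk memvf f'K mem_fil_dsum => /(_ isT)/andP[].
have := fdim_iso k.+1 isoN; rewrite fdim_dsum fdim_picket // subnn subn0.
have -> : fdim N k.+1 = fdim N l by rewrite /fdim fullk fullN.
move=> dimE; have [||ls [ls_path ls_gt0 isoM']] := IH M' k.+1 _ full'.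
- exact: admissible_dsumr (admissible_iso isoN gN).
- by move: dimN; rewrite dimE /=; lia.
exists (k.+1 :: ls); split=> //=; first by rewrite ls_path mink // fullN.
exact: iso_trans isoN (iso_dsumr _ isoM').
Qed.

End Decomposition.

(** * Numerical invariants of a multiset of pickets *)

Section Numeric.
Local Open Scope nat_scope.
Implicit Types ls : seq nat.

(** The dimension of the n-th step of the filtration of a sum of pickets. *)
Definition lendim ls n := \sum_(j <- ls) (uphalf j - uphalf (j - n)).

(** The dimensions of the filtration determine the multiplicities of the pickets,
    through a second difference. *)
Lemma count_lendim ls n : all (leq 1) ls -> 0 < n ->
  count_mem n ls + lendim ls n.-1 + lendim ls n.+2 = lendim ls n.+1 + lendim ls n.
Proof.
move=> + n_gt0; rewrite /lendim; elim: ls => [_|j ls IH /= /andP[j_gt0 /IH]].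
  by rewrite !big_nil.
have term : (j == n) + (uphalf j - uphalf (j - n.-1)) + (uphalf j - uphalf (j - n.+2))
    = (uphalf j - uphalf (j - n.+1)) + (uphalf j - uphalf (j - n)) by clear IH; lia.
by move=> eq_ls; rewrite !big_cons [X in X + _ = _]addnACA addnACA term eq_ls addnACA.
Qed.

(** Write M for the sum of the pickets with lengths in ls.  The sum on the left is
    dim Hom(M, P_j), and lendim ls 1 is dim U; so dim Hom(M, P_j) is
    dim K_(j+1)(M) for j odd, and dim K_(j+1)(M) - dim U for j even. *)
Lemma lendim_dual ls j : all (leq 1) ls -> 0 < j ->
  \sum_(l <- ls) (uphalf j - uphalf (j - l)) + (~~ odd j) * lendim ls 1 = lendim ls j.+1.
Proof.
move=> + j_gt0; rewrite /lendim; elim: ls => [_|l ls IH /= /andP[l_gt0 /IH]].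
  by rewrite !big_nil muln0.
have term : uphalf j - uphalf (j - l) + (~~ odd j) * (uphalf l - uphalf (l - 1))
    = uphalf l - uphalf (l - j.+1).
  by clear IH; have [?|?] := boolP (odd j); rewrite ?mul0n ?mul1n; lia.
by move=> eq_ls; rewrite !big_cons mulnDr addnACA term eq_ls.
Qed.

Lemma sum_leq_eq (ls : seq nat) (f g : nat -> nat) : (forall i, f i <= g i) ->
  \sum_(i <- ls) g i <= \sum_(i <- ls) f i -> {in ls, f =1 g}.
Proof.
move=> fg; elim: ls => [|l ls IH]; first by [].
rewrite !big_cons => le_gf i.
have sub_fg : \sum_(i <- ls) f i <= \sum_(i <- ls) g i by apply: leq_sum.
have := fg l; rewrite inE => lfg /orP[/eqP->|]; first by lia.
by apply: IH; lia.
Qed.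

(** Let M and M' be the sums of the pickets in ls and ls', and d n the difference
    dim K_n(M') - dim K_n(M).  By duality dim Hom(M, M') <= dim Hom(M', M'), and the
    hypothesis on the endomorphism rings makes this an equality; hence
    d (j + 1) = 0 whenever P_j occurs in M'.  So if d (n + 1) > 0, then P_n does not
    occur in M', and the formula for the multiplicities gives
    d (n + 1) + d n <= d (n - 1) + d (n + 2).  Let t be the last index with
    d t > 0.  Going down from t in steps of two, this inequality keeps d at least
    d t, down to the index 0 or 1, where d vanishes. *)
Lemma lendim_rigid ls ls' B : all (leq 1) ls -> all (leq 1) ls' ->
  lendim ls 1 = lendim ls' 1 -> (forall n, lendim ls n <= lendim ls' n) ->
  (forall n, B <= n -> lendim ls n = lendim ls' n) ->
  \sum_(l <- ls') lendim ls' l <= \sum_(l <- ls) lendim ls l ->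
  perm_eq ls ls'.
Proof.
move=> ls_gt0 ls'_gt0 eq1 le_len eqB le_end.
(* dim End(M') <= dim End(M) <= dim Hom(M, M'), where the outer terms are rewritten
   by duality as sums over the pickets of M'. *)
have eq_succ : {in ls', forall j, lendim ls j.+1 = lendim ls' j.+1}.
  apply: (sum_leq_eq (fun j => le_len j.+1)).
  have cross ls1 : all (leq 1) ls1 -> \sum_(l <- ls1) lendim ls' l
      + \sum_(j <- ls') (~~ odd j) * lendim ls1 1 = \sum_(j <- ls') lendim ls1 j.+1.
    move=> ls1_gt0; rewrite exchange_big -big_split /=.
    apply: eq_big_seq => j j_ls'; apply: lendim_dual => //.
    exact: (allP ls'_gt0).
  rewrite -!cross // eq1 leq_add2r (leq_trans le_end) //.
  by apply: leq_sum => l _; apply: le_len.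
pose d n := lendim ls' n - lendim ls n.
have dE n : lendim ls' n = lendim ls n + d n by rewrite subnKC.
have step n : 0 < n -> 0 < d n.+1 -> d n.+1 + d n <= d n.-1 + d n.+2.
  move=> n_gt0 dn; have c0 : count_mem n ls' = 0.
    apply/eqP; rewrite -leqn0 leqNgt -has_count has_pred1; apply/negP => /eq_succ.
    by have := dE n.+1; lia.
  have := count_lendim ls_gt0 n_gt0; have := count_lendim ls'_gt0 n_gt0.
  by rewrite c0 !dE; lia.
have d0 n : d n = 0.
  apply/eqP; rewrite -leqn0 leqNgt; apply/negP => dn_gt0.
  have exd : exists n, 0 < d n by exists n.
  have dB i : 0 < d i -> i <= B.
    by move=> di; rewrite leqNgt; apply/negP => /ltnW /eqB; have := dE i; lia.
  case: (ex_maxnP exd dB) => t dt maxt.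
  have dt1 : d t.+1 = 0.
    by apply/eqP; rewrite -leqn0 leqNgt; apply/negP => /maxt; rewrite ltnn.
  have down r : r.*2 <= t -> d t + d (t - r.*2).+1 <= d (t - r.*2).
    elim: r => [|r IH] rt; first by rewrite subn0 dt1 addn0.
    have {}IH : d t + d (t - r.*2).+1 <= d (t - r.*2) by apply: IH; lia.
    have := step (t - r.*2).-1; have -> : (t - r.*2).-1.+1 = t - r.*2 by lia.
    have -> : (t - r.*2).-1.-1 = t - r.+1.*2 by lia.
    have -> : (t - r.*2).-1 = (t - r.+1.*2).+1 by lia.
    by lia.
  have d00 : d 0 = 0.
    by rewrite /d /lendim !big1 // => j _; rewrite subn0 subnn.
  have d01 : d 1 = 0 by rewrite /d eq1 subnn.
  have := down t./2; have [->|->] : t - t./2.*2 = 0 \/ t - t./2.*2 = 1 by lia.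
    by rewrite d00; lia.
  by rewrite d01; lia.
apply/allP => n _ /=; apply/eqP; case: n => [|n].
  have no0 ls1 : all (leq 1) ls1 -> count_mem 0 ls1 = 0.
    by move=> /allP ls1_gt0; apply/count_memPn/negP => /ls1_gt0.
  by rewrite !no0.
have := count_lendim ls_gt0 (ltn0Sn n); have := count_lendim ls'_gt0 (ltn0Sn n).
by rewrite !dE !d0 /=; lia.
Qed.

End Numeric.

(** * Rigidity *)

Section Rigidity.

Variable K : fieldType.
Implicit Types M N : triple K.

(** The dimension of the endomorphism ring grows strictly with the dimensions of the
    filtration, when those of V and U are fixed. *)
Lemma iso_of_fdim_edim M M' : admissible M -> admissible M' ->
  \dim (fullv : {vspace carrier M}) = \dim (fullv : {vspace carrier M'}) ->
  \dim (sub M) = \dim (sub M') ->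
  (forall n, fdim M n <= fdim M' n)%N -> (edim M' <= edim M)%N -> iso M M'.
Proof.
move=> gM gM' dim_eq sub_eq le_fdim le_edim.
have [ls [ls_sorted ls_gt0 isoM]] := picket_decomposition gM.
have [ls' [ls'_sorted ls'_gt0 isoM']] := picket_decomposition gM'.
have fdimM n : fdim M n = lendim ls n by rewrite (fdim_iso n isoM) fdim_picket_sum.
have fdimM' n : fdim M' n = lendim ls' n by rewrite (fdim_iso n isoM') fdim_picket_sum.
have edimM : edim M = (\sum_(l <- ls) lendim ls l)%N.
  rewrite /edim (dim_homv_isol _ isoM) dim_homv_picket_sum //.
  by apply: eq_bigr => l _; apply: fdimM.
have edimM' : edim M' = (\sum_(l <- ls') lendim ls' l)%N.
  rewrite /edim (dim_homv_isol _ isoM') dim_homv_picket_sum //.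
  by apply: eq_bigr => l _; apply: fdimM'.
have [b fullM] := fil_full gM; have [b' fullM'] := fil_full gM'.
suff /(sorted_eq _ _ ls_sorted ls'_sorted) eq_ls : perm_eq ls ls'.
  apply: iso_trans isoM _; rewrite eq_ls; first exact: iso_sym.
    by move=> x y z; rewrite /geq /= => yx zy; apply: leq_trans zy yx.
  by move=> x y /andP[xy yx]; apply/eqP; rewrite eqn_leq; apply/andP.
apply: (@lendim_rigid _ _ (maxn b b')) => //.
- by rewrite -fdimM -fdimM'.
- by move=> n; rewrite -fdimM -fdimM'.
- move=> n; rewrite geq_max => /andP[bn b'n]; rewrite -fdimM -fdimM' /fdim.
  have /eqP -> : fil M n == fullv by rewrite eqEsubv subvf -fullM fil_leq.
  have /eqP -> // : fil M' n == fullv by rewrite eqEsubv subvf -fullM' fil_leq.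
- by rewrite -edimM -edimM'.
Qed.

End Rigidity.

(** * Semicontinuity along a line *)

Section Generic.

Variable K : fieldType.

(** The exceptional parameters are given as zeros of a polynomial, since they arise as
    zeros of minors; a product of polynomials then handles a conjunction. *)
Definition generically (P : K -> Prop) :=
  exists2 p : {poly K}, p != 0 & forall t, ~~ root p t -> P t.

Lemma generically_and P Q : generically P -> generically Q ->
  generically (fun t => P t /\ Q t).
Proof.
case=> p p0 pP [q q0 qQ]; exists (p * q); first by rewrite mulf_neq0.
by move=> t; rewrite rootM negb_or => /andP[/pP ? /qQ ?].
Qed.

Lemma generically_lt (P : nat -> K -> Prop) b : (forall n, generically (P n)) ->
  generically (fun t => forall n, (n < b)%N -> P n t).
Proof.
move=> gP; elim: b => [|b IH]; first by exists 1 => //; apply: oner_neq0.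
have [p p0 pP] := generically_and IH (gP b); exists p => // t /pP[lt_b Pb] n.
by rewrite ltnS leq_eqVlt => /orP[/eqP-> //|]; apply: lt_b.
Qed.

(** Choose P and Q such that P B(s) Q is the identity matrix of size rank B(s); the
    determinant of P B Q is a polynomial that is 1 at s, and away from its zeros
    the rank of B is at least rank B(s). *)
Lemma generic_rank m n (B : 'M[{poly K}]_(m, n)) (s : K) :
  generically (fun t =>
    (\rank (map_mx (horner_eval s) B) <= \rank (map_mx (horner_eval t) B))%N).
Proof.
set A := map_mx (horner_eval s) B; pose r := \rank A.
pose P := pinvmx (col_base A); pose Q := pinvmx (row_base A).
have PAQ : P *m A *m Q = 1%:M.
  rewrite -[X in P *m X *m Q](mulmx_base A) mulmxA mulVpmx ?col_base_full // mul1mx.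
  by rewrite mulmxVp ?row_base_free.
pose C := map_mx polyC P *m B *m map_mx polyC Q.
have evC t : map_mx (horner_eval t) C = P *m map_mx (horner_eval t) B *m Q.
  have evK k l (M : 'M[K]_(k, l)) : map_mx (horner_eval t) (map_mx polyC M) = M.
    by apply/matrixP=> i j; rewrite !mxE /horner_eval hornerC.
  by rewrite !map_mxM !evK.
exists (\det C) => [|t].
  apply: contraNneq (oner_neq0 K) => C0.
  rewrite -(det1 K r) -PAQ -evC det_map_mx C0.
  by rewrite raddf0.
rewrite /root -/(horner_eval t (\det C)) -det_map_mx evC => detC.
have unitC : P *m map_mx (horner_eval t) B *m Q \in unitmx.
  by rewrite unitmxE unitfE.
rewrite -/A -[X in (X <= _)%N](mxrank_unit unitC) (leq_trans (mxrankM_maxl _ _)) //.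
exact: mxrankM_maxr.
Qed.

Variables (V : vectType K) (U : {vspace V}).

(** The steps of the filtration as kernels of maps that depend polynomially on T;
    \1 - projv U is some map with kernel U. *)
Fixpoint filt_lfun (T : 'End(V)) n : 'End(V) :=
  match n with
  | 0 => \1%VF
  | 1 => (\1 - projv U)%VF
  | n'.+2 => (filt_lfun T n' \o T)%VF
  end.

Lemma lker_filt_lfun T n : lker (filt_lfun T n) = filt T U n.
Proof.
elim/ltn_ind: n => -[|[|n]] IH; apply/vspaceP=> v; rewrite memv_ker.
- by rewrite id_lfunE memv0.
- rewrite !lfun_simp subr_eq0 /=; apply/eqP/idP => [->|/projv_id -> //].
  exact: memv_proj.
- by rewrite comp_lfunE -memv_ker IH // -memv_preim.
Qed.

Import VectorInternalTheory.

Lemma f2mx_comp (f g : 'End(V)) : f2mx (f \o g)%VF = f2mx g *m f2mx f.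
Proof.
rewrite -[RHS]/(f2mx (Hom _)); congr f2mx; apply/lfunP=> v.
by rewrite comp_lfunE unlock /= !r2vK mulmxA.
Qed.

Lemma f2mx_lin a (f g : 'End(V)) : f2mx (f + a *: g) = f2mx f + a *: f2mx g.
Proof.
rewrite -[RHS]/(f2mx (Hom _)); congr f2mx; apply/lfunP=> v.
by rewrite !lfun_simp unlock /= mulmxDr -scalemxAr linearD linearZ.
Qed.

Lemma dim_filt_rank T n :
  (\dim (filt T U n) + \rank (f2mx (filt_lfun T n)) = \dim (fullv : {vspace V}))%N.
Proof.
rewrite -(limg_ker_dim (filt_lfun T n) fullv) capfv lker_filt_lfun; congr (_ + _)%N.
have limgE (f : 'End(V)) : limg f = lfun_img_def f fullv by rewrite unlock.
by rewrite limgE /dimv /= genmxE (eqmxMr _ (genmxE _)) mul1mx.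
Qed.

Lemma generic_filt (T0 T1 : 'End(V)) s n :
  generically (fun t => (\dim (filt (T0 + t *: T1)%R U n)
                         <= \dim (filt (T0 + s *: T1)%R U n))%N).
Proof.
pose B := fix B n : 'M[{poly K}]_(dim V) := match n with
  | 0 => 1%:M
  | 1 => map_mx polyC (f2mx (\1 - projv U)%VF)
  | n'.+2 => (map_mx polyC (f2mx T0) + 'X *: map_mx polyC (f2mx T1)) *m B n'
  end.
have evB t : map_mx (horner_eval t) (B n) = f2mx (filt_lfun (T0 + t *: T1)%R n).
  have evK k l (M : 'M[K]_(k, l)) : map_mx (horner_eval t) (map_mx polyC M) = M.
    by apply/matrixP=> i j; rewrite !mxE /horner_eval hornerC.
  elim/ltn_ind: n => -[|[|n]] IH.
  - rewrite map_mx1 /=; apply/row_matrixP=> i.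
    have := id_lfunE (r2v (row i 1%:M) : V); rewrite unlock /= r2vK => /r2v_inj.
    by rewrite -row_mul mul1mx.
  - exact: evK.
  - rewrite /= f2mx_comp map_mxM IH //; congr (_ *m _).
    rewrite map_mxD evK f2mx_lin; congr (_ + _).
    have evX : horner_eval t 'X = t by rewrite /horner_eval hornerX.
    by rewrite map_mxZ evK /= evX.
have [p p0 pB] := generic_rank (B n) s; exists p => // t /pB; rewrite !evB.
have := dim_filt_rank (T0 + s *: T1)%R n; have := dim_filt_rank (T0 + t *: T1)%R n.
move=> dim_t dim_s le_rank; rewrite -(leq_add2r (\rank (f2mx (filt_lfun (T0 + t *: T1)%R n)))).
by rewrite dim_t -dim_s leq_add2l.
Qed.

(** A common bound b for the nilpotency indices leaves finitely many conditions: from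
    2b on, the filtration is the whole space. *)
Lemma generic_fdim (T : K -> 'End(V)) T0 T1 b s :
  (forall t, T t = T0 + t *: T1) -> (forall t v, iter b (T t) v = 0) ->
  generically (fun t => forall n,
    (fdim (Triple (T t) U) n <= fdim (Triple (T s) U) n)%N).
Proof.
move=> TE Tb.
have [|p p0 pP] := generically_lt b.*2 (P := fun n t =>
    (fdim (Triple (T t) U) n <= fdim (Triple (T s) U) n)%N).
  by move=> n; have [p p0 pP] := generic_filt T0 T1 s n; exists p => // t /pP; rewrite -!TE.
exists p => // t /pP lt_b n; have [/lt_b //|bn] := ltnP n b.*2.
rewrite [X in (_ <= X)%N]/fdim (_ : fil _ n = fullv) ?dimvS ?subvf //.
apply/vspaceP=> v; rewrite memvf -[n](subnK bn) mem_fil_iter /= Tb.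
exact: mem0v.
Qed.

End Generic.

Lemma closed_generic (K : closedFieldType) (P : K -> Prop) :
  generically P -> exists t, P t.
Proof. by case=> p /closed_nonrootP[t /negP ?] pP; exists t; apply: pP; apply/negP. Qed.

(** * Triples of invariant subspaces *)

Section Dictionary.

Variable K : fieldType.
Implicit Types X Y Z : objS K.

Definition triple_of Z : triple K :=
  @Triple K (N K (beta Z)) (mulT K (beta Z)) (limg (emb Z)).

Lemma emb_in_sub Z a : emb Z a \in sub (triple_of Z).
Proof. exact/memv_img/memvf. Qed.

Lemma emb_mulT Z a : emb Z (mulT K (alpha Z) a) = mulT K (beta Z) (emb Z a).
Proof. by have /KT_homE/lfunP/(_ a) := @emb_hom K Z; rewrite !comp_lfunE. Qed.

Lemma mor_hom X Y (f : morS X Y) : @is_hom K (triple_of X) (triple_of Y) (mor2 f).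
Proof.
split=> [v|_ /memv_imgP[a _ ->]].
  by have /KT_homE/lfunP/(_ v) := mor2_hom f; rewrite !comp_lfunE.
have /lfunP/(_ a) := mor_comm f; rewrite !comp_lfunE => <-; exact: emb_in_sub.
Qed.

(** A map of the ambient modules that preserves the subspaces has a unique
    restriction to them, which is automatically K[T]-linear. *)
Lemma hom_mor X Y f : @is_hom K (triple_of X) (triple_of Y) f -> exists h : morS X Y, mor2 h = f.
Proof.
move=> [fT fU]; pose g := ((emb Y)^-1 \o (f \o emb X))%VF.
have gE a : emb Y (g a) = f (emb X a).
  by rewrite !comp_lfunE limg_lfunVK //; apply/fU/emb_in_sub.
have g_hom : is_KT_hom g.
  apply/KT_homE/lfunP=> a; apply: (@emb_inj K Y).
  by rewrite comp_lfunE gE emb_mulT [f _]fT -gE comp_lfunE emb_mulT.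
have f_hom : is_KT_hom f by apply/KT_homE/lfunP=> v; rewrite !comp_lfunE [LHS]fT.
have comm : (emb Y \o g = f \o emb X)%VF by apply/lfunP=> a; rewrite comp_lfunE gE comp_lfunE.
by exists (MorS g_hom f_hom comm).
Qed.

Lemma iso_isoS X Y : iso (triple_of X) (triple_of Y) -> isoS X Y.
Proof.
case=> f [g [hf hg fK gK]].
have [f' f'E] := hom_mor hf; have [g' g'E] := hom_mor hg; exists f', g'.
have m1 A B (h : morS A B) a : emb B (mor1 h a) = mor2 h (emb A a).
  by have /lfunP/(_ a) := mor_comm h; rewrite !comp_lfunE.
split; apply/lfunP=> v; rewrite comp_lfunE id_lfunE.
- by apply: (@emb_inj K X); rewrite !m1 f'E g'E fK.
- by apply: (@emb_inj K Y); rewrite !m1 f'E g'E gK.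
- by rewrite f'E g'E fK.
- by rewrite f'E g'E gK.
Qed.

Lemma edim_triple_of Z : edim (triple_of Z) = \dim (endS Z).
Proof.
have emb0 := introT lker0P (@emb_inj K Z).
apply/eqP; rewrite eqn_leq; apply/andP; split.
  apply: (dimv_leq_inj (f := fun f : 'End(N K (beta Z)) =>
    (((emb Z)^-1 \o (f \o emb Z))%VF, f))).
  - by move=> a u v; congr (_, _); apply/lfunP=> x; rewrite /= !lfun_simp linearP.
  - move=> f /(@mem_homv K (triple_of Z) (triple_of Z))/hom_mor[h <-].
    apply/mem_endS; exists h; congr (_, _).
    by rewrite -mor_comm comp_lfunA lker0_compVf // comp_lfun1l.
  - by move=> f _ [].
apply: (dimv_leq_inj (f := fun p : 'End(N K (alpha Z)) * 'End(N K (beta Z)) => p.2)).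
- by [].
- by move=> p /mem_endS[h ->]; apply/(@mem_homv K (triple_of Z) (triple_of Z)); apply: mor_hom.
move=> p /mem_endS[h ->] /= h0; rewrite h0; congr (_, _).
apply/lfunP=> a; apply: (@emb_inj K Z); rewrite zero_lfunE linear0.
by have /lfunP/(_ a) := mor_comm h; rewrite !comp_lfunE h0 zero_lfunE.
Qed.

Lemma alpha_nseq Z : in_S1 Z -> alpha Z = nseq (size (alpha Z)) 1%N.
Proof.
rewrite /in_S1; have /andP[a_sorted a0] := alpha_partition Z.
move=> a1; apply/all_pred1P/allP=> m ma /=.
have m0 : m != 0%N by apply: contraNneq a0 => <-.
suff : (m <= 1)%N by lia.
case: (alpha Z) a_sorted a1 ma => //= k s k_path k1; rewrite inE => /orP[/eqP-> //|ms].
apply: leq_trans k1; have geq_trans : transitive geq.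
  by move=> x y z xy yz; apply: leq_trans yz xy.
by have /allP/(_ m ms) := order_path_min geq_trans k_path.
Qed.

Lemma mulT_nseq1 n v : mulT K (nseq n 1%N) v = 0.
Proof.
rewrite mulTE; elim: n v => [|n IH] /= v; first exact: thinmx0.
rewrite IH (_ : in_qpoly _ _ * _ = 0) //; apply: (@truncatedP K 1) => // i i1.
by rewrite coef_mulX_truncated // coef0 ifF //; lia.
Qed.

Lemma mulT_nilp s : (0%N \notin s) -> exists n, forall v, iter n (mulT K s) v = 0.
Proof.
elim: s => [|m s IH]; first by exists 0%N => v; apply: thinmx0.
rewrite inE negb_or eq_sym -lt0n => /andP[m_gt0 /IH[n sn]].
exists (m + n)%N => -[a w].
have -> k : iter k (mulT K (m :: s)) (a, w) = (iter k (shift K m) a, iter k (mulT K s) w).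
  elim: k => //= k ->; rewrite shiftE mulTE.
  exact: (@mulTE K (m :: s) (_, _)).
congr (_, _); last by rewrite iterD sn iter_linear0.
apply: (truncatedP m_gt0) => i im; rewrite coef_iter_shift // ifF ?coef0 //.
by lia.
Qed.

(** This is where the semisimplicity of N_alpha enters: T kills U. *)
Lemma admissible_triple_of Z : in_S1 Z -> admissible (triple_of Z).
Proof.
move=> Z1; split=> [_ /memv_imgP[a _ ->]|].
  rewrite /= -emb_mulT (_ : mulT K _ a = 0) ?linear0 //.
  by move: a; rewrite (alpha_nseq Z1) => a; apply: mulT_nseq1.
by have /andP[_ /mulT_nilp] := beta_partition Z.
Qed.

Lemma fullv_prod (V W : vectType K) :
  fullv = prodv (fullv : {vspace V}) (fullv : {vspace W}).
Proof. by apply/vspaceP=> x; rewrite mem_prodv !memvf. Qed.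

Lemma dim_N_nseq1 n : \dim (fullv : {vspace N K (nseq n 1%N)}) = n.
Proof.
elim: n => [|n IH] /=; first by rewrite dimvf.
by rewrite fullv_prod dim_prodv IH dim_polyn size_truncated.
Qed.

Lemma embedding_onto (A V : vectType K) (U : {vspace V}) :
  \dim (fullv : {vspace A}) = \dim U ->
  exists2 e : 'Hom(A, V), injective e & limg e = U.
Proof.
move=> dimA.
have [b b_basis] : exists b : (\dim U).-tuple A, basis_of fullv b.
  by rewrite -dimA; exists (vbasis fullv); apply: vbasisP.
pose f (v : A) := \sum_(i < \dim U) coord b i v *: (vbasis U)`_i.
have fL : linear f.
  move=> a u v; rewrite /f scaler_sumr -big_split; apply: eq_bigr => i _.
  by rewrite linearP scalerDl scalerA.
have e_inj : injective (linfun f).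
  move=> u v; rewrite !linfunE // => eq_f.
  rewrite (coord_basis b_basis (memvf u)) (coord_basis b_basis (memvf v)).
  apply: eq_bigr => i _; congr (_ *: _).
  have := congr1 (coord (vbasis U) i) eq_f.
  by rewrite !coord_sum_free // (basis_free (vbasisP U)).
exists (linfun f) => //; apply/eqP; rewrite eqEdim; apply/andP; split.
  apply/subvP=> _ /memv_imgP[v _ ->]; rewrite linfunE //.
  by apply: rpred_sum => i _; rewrite memvZ // vbasis_mem // mem_nth ?size_tuple.
rewrite limg_dim_eq ?dimA // (_ : lker _ = 0%VS) ?capv0 //.
by apply/eqP/lker0P.
Qed.

(** N_alpha has to be the semisimple module of the dimension of U. *)
Lemma realize_sub s (U : {vspace N K s}) : is_partition s ->
  (forall u, u \in U -> mulT K s u = 0) ->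
  exists2 Z, in_S1 Z & triple_of Z = @Triple K (N K s) (mulT K s) U.
Proof.
move=> s_part U0; pose a := nseq (\dim U) 1%N.
have [e e_inj eU] := embedding_onto (dim_N_nseq1 (\dim U)).
have e_hom : is_KT_hom e.
  apply/KT_homE/lfunP=> v; rewrite !comp_lfunE mulT_nseq1 linear0 U0 //.
  by have := memv_img e (memvf v); rewrite eU.
have a_part : is_partition a.
  rewrite /is_partition /a; apply/andP; split; last first.
    by apply/negP => /nseqP[].
  by elim: (\dim U) => // -[|n].
exists (ObjS a_part s_part e_hom e_inj); last by rewrite /triple_of /= eU.
by rewrite /in_S1 /= /a; case: (\dim U).
Qed.

Lemma picket_sum_carrier ls : all (leq 1) ls ->
  exists (f : 'Hom(N K (map uphalf ls), carrier (picket_sum K ls)))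
    (g : 'Hom(carrier (picket_sum K ls), N K (map uphalf ls))),
  [/\ cancel f g, cancel g f & forall v, f (mulT K (map uphalf ls) v) = op (picket_sum K ls) (f v)].
Proof.
elim: ls => [_|l ls IH /= /andP[l_gt0 /IH[f [g [fK gK fT]]]]].
  by exists (@id_lfun K _), (@id_lfun K _); split=> v; rewrite [v]thinmx0 !linear0.
have fL : linear (fun v : N K (uphalf l :: map uphalf ls) => (v.1, f v.2)).
  by move=> a u v; congr (_, _); rewrite /= linearP.
have gL : linear (fun v : carrier (picket_sum K (l :: ls)) => (v.1, g v.2)).
  by move=> a u v; congr (_, _); rewrite /= linearP.
exists (linfun (fun v : N K (uphalf l :: map uphalf ls) => (v.1, f v.2))).
exists (linfun (fun v : carrier (picket_sum K (l :: ls)) => (v.1, g v.2))); split=> -[x y].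
- by rewrite (linfunE gL) (linfunE fL) /= fK.
- by rewrite (linfunE fL) (linfunE gL) /= gK.
apply: etrans (esym (@op_dsum K (picket K l) (picket_sum K ls) _)).
rewrite !(linfunE fL) (@mulTE K (uphalf l :: map uphalf ls)) /=.
by rewrite -fT mulTE shiftE.
Qed.

(** Every admissible triple comes from an object of S_1, so that the minimality of a
    generic extension can be tested on triples. *)
Lemma realize M : admissible M -> exists2 Z, in_S1 Z & iso M (triple_of Z).
Proof.
move=> gM; have [ls [ls_sorted ls_gt0 isoM]] := picket_decomposition gM.
have [f [g [fK gK fT]]] := picket_sum_carrier ls_gt0.
have [stdU _] := admissible_iso isoM gM.
have gT v : g (op (picket_sum K ls) v) = mulT K (map uphalf ls) (g v).
  by rewrite -[v in LHS]gK -fT fK.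
have [||Z Z1 trZ] := @realize_sub (map uphalf ls) (g @: sub (picket_sum K ls))%VS.
- rewrite /is_partition; apply/andP; split.
    by apply: homo_sorted ls_sorted => x y /=; rewrite /geq /=; lia.
  apply/negP => /mapP[l /(allP ls_gt0)]; lia.
- by move=> _ /memv_imgP[u uU ->]; rewrite -gT stdU ?linear0.
exists Z => //; rewrite trZ; apply: iso_trans isoM _; exists g, f; split=> //.
  by split=> // u uU; apply: memv_img.
by split=> // _ /memv_imgP[u uU ->]; rewrite gK.
Qed.

End Dictionary.

(** * Extensions in coordinates *)

Section Glue.

Variable K : fieldType.
Implicit Types A B M : triple K.
Implicit Types X Y Z : objS K.

(** The extension of B by A with cocycle C. *)
Definition glue A B (C : 'Hom(carrier B, carrier A)) : triple K := Triple
  (linfun (fun x : carrier A * carrier B => (op A x.1 + C x.2, op B x.2)))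
  (prodv (sub A) (sub B)).

Lemma op_glue A B C x : op (@glue A B C) x = (op A x.1 + C x.2, op B x.2).
Proof.
rewrite linfunE // => a u v; congr (_, _); rewrite /= !linearP //=.
by rewrite scalerDr addrACA.
Qed.

Definition vanishes B (V : vectType K) (C : 'Hom(carrier B, V)) :=
  {in sub B, forall u, C u = 0}.

(** The nilpotency index of the extension is bounded independently of C. *)
Lemma iter_glue A B C a b :
  (forall v, iter a (op A) v = 0) -> (forall v, iter b (op B) v = 0) ->
  forall x, iter (a + b) (op (@glue A B C)) x = 0.
Proof.
move=> A0 B0 x.
have snd_iter k y : (iter k (op (glue C)) y).2 = iter k (op B) y.2.
  by elim: k => //= k IH; rewrite op_glue /= IH.
have fst_iter k v : iter k (op (glue C)) (v, 0) = (iter k (op A) v, 0).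
  by elim: k => //= k ->; rewrite op_glue /= !linear0 addr0.
rewrite iterD; case E: (iter b _ x) (snd_iter b x) => [v w] /=.
by rewrite B0 => ->; rewrite fst_iter A0.
Qed.

Lemma admissible_glue A B C : admissible A -> admissible B -> vanishes C -> admissible (@glue A B C).
Proof.
move=> [AU [a A0]] [BU [b B0]] CU; split; last first.
  by exists (a + b)%N; apply: iter_glue.
move=> x; rewrite mem_prodv => /andP[x1 x2].
by rewrite op_glue AU // BU // CU // addr0.
Qed.

(** On U_B the section sU of q takes values in U_M; it is extended to a section s of
    q on the whole of B by an arbitrary section on a complement.  The identification
    is (a, b) |-> i a + s b, and C is the defect T s - s T, which takes values in
    the kernel of q and vanishes on U_B because T kills U_M and U_B. *)
Lemma sequence_glue A B M (i : 'Hom(carrier A, carrier M)) (q : 'Hom(carrier M, carrier B))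
    (sU : 'Hom(carrier B, carrier M)) :
  is_hom i -> is_hom q -> lker i = 0%VS -> limg i = lker q -> limg q = fullv ->
  {in sub M, forall u, q u = 0 -> exists2 a, a \in sub A & u = i a} ->
  {in sub B, forall u, q (sU u) = u} -> {in sub B, forall u, sU u \in sub M} ->
  {in sub M, forall u, op M u = 0} -> {in sub B, forall u, op B u = 0} ->
  exists2 C : 'Hom(carrier B, carrier A), vanishes C & iso M (glue C).
Proof.
move=> [iT iU] [qT qU] i0 iq q_full ker_sub qsU sU_sub MU BU.
pose i' := (i^-1)%VF; pose r := (q^-1)%VF.
have iK : cancel i i' by apply: lker0_lfunK; rewrite i0.
have qr y : q (r y) = y by rewrite limg_lfunVK // q_full memvf.
have qi a : q (i a) = 0 by apply/eqP; rewrite -memv_ker -iq memv_img ?memvf.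
have ker_q z : q z = 0 -> i (i' z) = z.
  by move=> qz; apply: limg_lfunVK; rewrite iq memv_ker qz.
pose P := projv (sub B).
pose s : 'Hom(carrier B, carrier M) := ((sU \o P) + (r \o (\1 - P)))%VF.
have sE y : s y = sU (P y) + r (y - P y) by rewrite !lfun_simp. 
have qs y : q (s y) = y.
  by rewrite sE linearD /= qr qsU ?memv_proj // addrC subrK.
have sB u : u \in sub B -> s u \in sub M.
  by move=> uB; rewrite sE /P projv_id // subrr linear0 addr0 sU_sub.
pose C : 'Hom(carrier B, carrier A) := (i' \o ((op M \o s) - (s \o op B)))%VF.
have CE y : C y = i' (op M (s y) - s (op B y)) by rewrite !lfun_simp.
have iC y : i (C y) = op M (s y) - s (op B y).
  by rewrite CE ker_q // linearB /= qT !qs subrr.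
have fL : linear (fun z => (i' (z - s (q z)), q z)).
  move=> a u v; congr (_, _) => /=; last by rewrite linearP.
  have -> : a *: u + v - s (q (a *: u + v)) = a *: (u - s (q u)) + (v - s (q v)).
    by rewrite !linearP scalerDr addrACA.
  by rewrite linearP.
have gL : linear (fun x : carrier A * carrier B => i x.1 + s x.2).
  by move=> a u v; rewrite /= !linearP scalerDr addrACA.
have qz0 z : q (z - s (q z)) = 0 by rewrite linearB /= qs subrr.
have gfK z : i (i' (z - s (q z))) + s (q z) = z by rewrite ker_q // subrK.
have gT x : i (op (glue C) x).1 + s (op (glue C) x).2 = op M (i x.1 + s x.2).
  by rewrite op_glue /= !linearD /= iT iC addrA subrK.
have fgK (x : carrier A * carrier B) :
    (i' (i x.1 + s x.2 - s (q (i x.1 + s x.2))), q (i x.1 + s x.2)) = x.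
  by case: x => a b /=; rewrite [q _]linearD /= qi qs add0r addrK iK.
exists C => [u uB|]; first by rewrite CE BU // MU ?sB // linear0 subrr linear0.
exists (linfun (fun z => (i' (z - s (q z)), q z))).
exists (linfun (fun x : carrier A * carrier B => i x.1 + s x.2)); split.
- split=> [z|u uM].
    rewrite !(linfunE fL) -[RHS]fgK gT /= gfK //.
  rewrite mem_prodv (linfunE fL) /= qU // andbT.
  have [||a aA ->] := ker_sub (u - s (q u)); [|exact: qz0|by rewrite iK].
  by rewrite memvB // sB // qU.
- split=> [x|x]; rewrite !(linfunE gL); first exact: gT.
  by rewrite mem_prodv => /andP[x1 x2]; rewrite memvD ?iU ?sB.
- by move=> z; rewrite (linfunE gL) (linfunE fL) /= gfK.
- by move=> x; rewrite (linfunE fL) (linfunE gL); apply: fgK.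
Qed.

Lemma emb_mor X Y (f : morS X Y) a : emb Y (mor1 f a) = mor2 f (emb X a).
Proof. by have /lfunP/(_ a) := mor_comm f; rewrite !comp_lfunE. Qed.

(** Exactness in the first component provides the section on U that respects the
    subspaces, and shows that the kernel of U_Z -> U_Y is U_X. *)
Lemma extension_glue X Y Z : in_S1 Y -> is_extension Y X Z ->
  exists2 C : 'Hom(carrier (triple_of Y), carrier (triple_of X)),
    vanishes C & iso (triple_of Z) (glue C).
Proof.
move=> Y1 [Z1 [i [q [[i1_0 iq1 q1_full] [i2_0 iq2 q2_full]]]]].
have emb0 W : lker (emb W) == 0%VS := introT lker0P (@emb_inj K W).
pose sU := (emb Z \o ((mor1 q)^-1 \o (emb Y)^-1))%VF.
apply: (@sequence_glue (triple_of X) (triple_of Y) (triple_of Z) (mor2 i) (mor2 q) sU) => //.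
- exact: mor_hom.
- exact: mor_hom.
- move=> _ /memv_imgP[a _ ->] qa0.
  have : a \in limg (mor1 i).
    by rewrite iq1 memv_ker; apply/eqP/(@emb_inj K Y); rewrite emb_mor linear0.
  case/memv_imgP=> b _ ->; exists (emb X b); first exact: emb_in_sub.
  exact: emb_mor.
- move=> _ /memv_imgP[b _ ->]; rewrite !comp_lfunE lker0_lfunK // -emb_mor.
  by rewrite limg_lfunVK // q1_full memvf.
- by move=> u _; rewrite comp_lfunE; apply: emb_in_sub.
- exact: (proj1 (admissible_triple_of Z1)).
- exact: (proj1 (admissible_triple_of Y1)).
Qed.

Lemma glue_extension X Y Z (C : 'Hom(carrier (triple_of Y), carrier (triple_of X))) :
  in_S1 Z -> iso (triple_of Z) (glue C) -> is_extension Y X Z.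
Proof.
move=> Z1 [f [g [hf hg fK gK]]]; split=> //.
have inL : linear (fun x : carrier (triple_of X) => (x, 0 : carrier (triple_of Y))).
  by move=> a u v; congr (_, _); rewrite /= scaler0 addr0.
have outL : linear (fun x : carrier (triple_of X) * carrier (triple_of Y) => x.2) by [].
have hin : @is_hom K (triple_of X) (glue C) (linfun (fun x : carrier (triple_of X) => (x, 0))).
  split=> [x|u uX]; first by rewrite op_glue !(linfunE inL) /= !linear0 addr0.
  by rewrite mem_prodv (linfunE inL) /= uX mem0v.
have hout : @is_hom K (glue C) (triple_of Y)
    (linfun (fun x : carrier (triple_of X) * carrier (triple_of Y) => x.2)).
  split=> [x|u]; first by rewrite !(linfunE outL) op_glue.
  by rewrite mem_prodv (linfunE outL) => /andP[].
have [i iE] := hom_mor (hom_comp hin hg); have [q qE] := hom_mor (hom_comp hf hout).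
have i2E x : mor2 i x = g (x, 0) by rewrite iE comp_lfunE (linfunE inL).
have q2E z : mor2 q z = (f z).2 by rewrite qE comp_lfunE (linfunE outL).
have qi2 x : mor2 q (mor2 i x) = 0 by rewrite i2E q2E gK.
exists i, q; split; split.
- apply/eqP/lker0P=> a b ab; apply: (@emb_inj K X).
  have := congr1 (emb Z) ab; rewrite !emb_mor !i2E => /(can_inj gK).
  by case.
- apply/vspaceP=> a; rewrite memv_ker; apply/memv_imgP/eqP.
    case=> b _ ->; apply: (@emb_inj K Y).
    by rewrite !emb_mor qi2 linear0.
  move=> qa0; have := proj2 hf _ (emb_in_sub a).
  rewrite mem_prodv => /andP[/memv_imgP[b _ fb] _]; exists b; first exact: memvf.
  apply: (@emb_inj K Z); rewrite emb_mor i2E -[LHS]fK; congr (g _).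
  rewrite [LHS]surjective_pairing fb; congr (_, _).
  by rewrite -q2E -emb_mor qa0 linear0.
- apply/vspaceP=> b; rewrite memvf; apply/memv_imgP.
  have gb : ((0, emb Y b) : carrier (glue C)) \in sub (glue C).
    by rewrite mem_prodv mem0v emb_in_sub.
  have /memv_imgP[a _ ga] := proj2 hg _ gb; exists a; first exact: memvf.
  by apply: (@emb_inj K Y); rewrite emb_mor q2E -ga gK.
- apply/eqP/lker0P=> a b; rewrite !i2E => /(can_inj gK).
  by case.
- apply/vspaceP=> v; rewrite memv_ker; apply/memv_imgP/eqP.
    by case=> b _ ->; apply: qi2.
  rewrite q2E => fv; exists (f v).1; first exact: memvf.
  by rewrite i2E -fv -surjective_pairing fK.
- apply/vspaceP=> b; rewrite memvf; apply/memv_imgP.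
  by exists (g (0, b)); [apply: memvf | rewrite q2E gK].
Qed.

Lemma glue_isol A A' B C : iso A A' ->
  exists2 C' : 'Hom(carrier B, carrier A'),
    vanishes (B := B) C -> vanishes (B := B) C' & iso (@glue A B C) (glue C').
Proof.
case=> f [g [[fT fU] [gT gU] fK gK]]; exists (f \o C)%VF.
  by move=> C0 u uB; rewrite comp_lfunE C0 ?linear0.
have fL : linear (fun x : carrier A * carrier B => (f x.1, x.2)).
  by move=> a u v; congr (_, _); rewrite /= linearP.
have gL : linear (fun x : carrier A' * carrier B => (g x.1, x.2)).
  by move=> a u v; congr (_, _); rewrite /= linearP.
exists (linfun (fun x : carrier A * carrier B => (f x.1, x.2))).
exists (linfun (fun x : carrier A' * carrier B => (g x.1, x.2))); split.
- split=> x; first by rewrite !op_glue !(linfunE fL) /= linearD /= fT comp_lfunE.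
  by rewrite !mem_prodv (linfunE fL) /= => /andP[/fU-> ->].
- split=> x; first by rewrite !op_glue !(linfunE gL) /= linearD /= gT comp_lfunE fK.
  by rewrite !mem_prodv (linfunE gL) /= => /andP[/gU-> ->].
- by case=> x y; rewrite (linfunE fL) (linfunE gL) /= fK.
- by case=> x y; rewrite (linfunE gL) (linfunE fL) /= gK.
Qed.

Lemma glue_isor A B B' C : iso B B' ->
  exists2 C' : 'Hom(carrier B', carrier A),
    vanishes (B := B) C -> vanishes (B := B') C' & iso (@glue A B C) (glue C').
Proof.
case=> f [g [[fT fU] [gT gU] fK gK]]; exists (C \o g)%VF.
  by move=> C0 u uB; rewrite comp_lfunE C0 ?gU.
have fL : linear (fun x : carrier A * carrier B => (x.1, f x.2)).
  by move=> a u v; congr (_, _); rewrite /= linearP.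
have gL : linear (fun x : carrier A * carrier B' => (x.1, g x.2)).
  by move=> a u v; congr (_, _); rewrite /= linearP.
exists (linfun (fun x : carrier A * carrier B => (x.1, f x.2))).
exists (linfun (fun x : carrier A * carrier B' => (x.1, g x.2))); split.
- split=> x; first by rewrite !op_glue !(linfunE fL) /= fT comp_lfunE fK.
  by rewrite !mem_prodv (linfunE fL) /= => /andP[-> /fU].
- split=> x; first by rewrite !op_glue !(linfunE gL) /= gT comp_lfunE.
  by rewrite !mem_prodv (linfunE gL) /= => /andP[-> /gU].
- by case=> x y; rewrite (linfunE fL) (linfunE gL) /= fK.
- by case=> x y; rewrite (linfunE gL) (linfunE fL) /= gK.
Qed.

(** An extension of D by an extension of B by A; the type of F does not depend on c,
    so that both can move along a line. *)
Definition glue3 A B D (c : 'Hom(carrier B, carrier A))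
  (F : 'Hom(carrier D, (carrier A * carrier B)%type)) : triple K := @glue (glue c) D F.

(** Both sides are the same lower triangular operator on A + B + D, filtered once
    by A + B and once by A. *)
Lemma glue_assoc A B D (c : 'Hom(carrier B, carrier A))
    (F : 'Hom(carrier D, (carrier A * carrier B)%type)) (e : 'Hom(carrier D, carrier B))
    (C : 'Hom((carrier B * carrier D)%type, carrier A)) :
  (forall w, (F w).2 = e w) ->
  (forall v w, C (v, w) = c v + (F w).1) ->
  iso (@glue3 A B D c F) (@glue A (@glue B D e) C).
Proof.
move=> Fe Cc.
pose f (x : carrier (@glue3 A B D c F)) : carrier (@glue A (@glue B D e) C) :=
  (x.1.1, (x.1.2, x.2)).
pose g (x : carrier (@glue A (@glue B D e) C)) : carrier (@glue3 A B D c F) :=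
  ((x.1, x.2.1), x.2.2).
have fL : linear f by [].
have gL : linear g by [].
have fT x : f (op (@glue3 A B D c F) x) = op (@glue A (@glue B D e) C) (f x).
  by case: x => [[a b] d]; rewrite /f !op_glue /= Fe Cc addrA.
have fU x : (f x \in sub (@glue A (@glue B D e) C)) = (x \in sub (@glue3 A B D c F)).
  rewrite [LHS]mem_prodv [RHS]mem_prodv /=.
  by rewrite [X in _ && X]mem_prodv [X in _ = X && _]mem_prodv andbA.
have gK' x : x = f (g x) by case: x => ? [].
have fK' x : g (f x) = x by case: x => -[].
exists (linfun f), (linfun g); split.
- split=> x; first by rewrite !(linfunE fL) fT.
  by rewrite (linfunE fL) fU.
- split=> x; last by rewrite (linfunE gL) -fU -gK'.
  by rewrite !(linfunE gL) -[RHS]fK' fT -gK'.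
- by move=> x; rewrite (linfunE fL) (linfunE gL); case: x => -[].
- by move=> x; rewrite (linfunE gL) (linfunE fL); case: x => ? [].
Qed.

(** An extension M of Y by X that is at least as generic as the generic extension V
    is isomorphic to V; here M0 is a coordinate form of V whose dimensions can be
    compared with those of M. *)
Lemma generic_extension_iso X Y V M M0 (C : 'Hom(carrier (triple_of Y), carrier (triple_of X))) :
  is_generic_extension Y X V -> iso (triple_of V) M0 -> admissible M -> iso M (glue C) ->
  \dim (fullv : {vspace carrier M}) = \dim (fullv : {vspace carrier M0}) ->
  \dim (sub M) = \dim (sub M0) ->
  (forall n, fdim M n <= fdim M0 n)%N -> iso M (triple_of V).
Proof.
move=> [[V1 _] minV] isoV gM isoM eq_dim eq_sub le_fdim.
have [W W1 isoW] := realize gM.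
have extW : is_extension Y X W.
  exact: glue_extension W1 (iso_trans (iso_sym isoW) isoM).
apply: iso_trans (iso_sym isoV).
apply: iso_of_fdim_edim => //; first exact: admissible_iso isoV (admissible_triple_of V1).
rewrite -(edim_iso isoV) (edim_iso isoW) !edim_triple_of; exact: minV.
Qed.

End Glue.

(** * Lines of extensions *)

Section Line.

Variable K : fieldType.

Definition line (V : lmodType K) (u v : V) (t : K) : V := u + t *: (v - u).

Lemma line0 V u v : @line V u v 0 = u.
Proof. by rewrite /line scale0r addr0. Qed.

Lemma line1 V u v : @line V u v 1 = v.
Proof. by rewrite /line scale1r addrC subrK. Qed.

Lemma lineE (V W : vectType K) (f g : 'Hom(V, W)) t v :
  line f g t v = line (f v) (g v) t.
Proof. by rewrite /line !lfun_simp. Qed.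

Lemma line_id (V : lmodType K) (v : V) t : line v v t = v.
Proof. by rewrite /line subrr scaler0 addr0. Qed.

Lemma lineD (V : lmodType K) (u v u' v' : V) t :
  line u v t + line u' v' t = line (u + u') (v + v') t.
Proof. by rewrite /line addrACA -scalerDr opprD -addrACA. Qed.

Lemma line_pair (V W : vectType K) (a b : V) (a' b' : W) t :
  (line a b t, line a' b' t) = line ((a, a') : (V * W)%type) (b, b') t.
Proof. by []. Qed.

Lemma op_glue_line (A B : triple K) (C0 C1 : 'Hom(carrier B, carrier A)) t :
  op (glue (line C0 C1 t)) = line (op (glue C0)) (op (glue C1)) t.
Proof.
apply/lfunP=> x; rewrite lineE op_glue lineE (@op_glue K A B C0) (@op_glue K A B C1).
transitivity (line (op A x.1 + C0 x.2) (op A x.1 + C1 x.2) t,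
              line (op B x.2) (op B x.2) t); last exact: line_pair.
by rewrite -lineD !line_id.
Qed.

Lemma op_glue3_line (A B D : triple K) (c0 c1 : 'Hom(carrier B, carrier A))
    (F0 F1 : 'Hom(carrier D, (carrier A * carrier B)%type)) t :
  op (glue3 (line c0 c1 t) (line F0 F1 t)) = line (op (glue3 c0 F0)) (op (glue3 c1 F1)) t.
Proof.
apply/lfunP=> x; rewrite lineE op_glue lineE op_glue_line lineE.
rewrite (@op_glue K (glue c0) D F0) (@op_glue K (glue c1) D F1).
transitivity (line (op (glue c0) x.1 + F0 x.2) (op (glue c1) x.1 + F1 x.2) t,
              line (op D x.2) (op D x.2) t); last exact: line_pair.
by rewrite -lineD line_id.
Qed.

Lemma generic_glue (A B : triple K) (C0 C1 : 'Hom(carrier B, carrier A)) s :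
  admissible A -> admissible B ->
  generically (fun t => forall n,
    (fdim (glue (line C0 C1 t)) n <= fdim (glue (line C0 C1 s)) n)%N).
Proof.
move=> [_ [a A0]] [_ [b B0]].
apply: (@generic_fdim K (carrier A * carrier B)%type (prodv (sub A) (sub B))
  (fun t => op (glue (line C0 C1 t))) (op (glue C0)) (op (glue C1) - op (glue C0))
  (a + b) s) => t; first exact: op_glue_line.
exact: iter_glue.
Qed.

Lemma generic_glue3 (A B D : triple K) (c0 c1 : 'Hom(carrier B, carrier A))
    (F0 F1 : 'Hom(carrier D, (carrier A * carrier B)%type)) s :
  admissible A -> admissible B -> admissible D ->
  generically (fun t => forall n,
    (fdim (glue3 (line c0 c1 t) (line F0 F1 t)) n
     <= fdim (glue3 (line c0 c1 s) (line F0 F1 s)) n)%N).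
Proof.
move=> [_ [a A0]] [_ [b B0]] [_ [d D0]].
apply: (@generic_fdim K (carrier A * carrier B * carrier D)%type
  (prodv (prodv (sub A) (sub B)) (sub D))
  (fun t => op (glue3 (line c0 c1 t) (line F0 F1 t)))
  (op (glue3 c0 F0)) (op (glue3 c1 F1) - op (glue3 c0 F0)) (a + b + d) s) => t.
  exact: op_glue3_line.
by apply: (@iter_glue K (glue (line c0 c1 t)) D _ (a + b) d) => //; apply: iter_glue.
Qed.

End Line.

(** * Associativity *)

Theorem lemma6p4 (K : closedFieldType) (X Y Z : objS K) :
  in_S1 X -> in_S1 Y -> in_S1 Z ->
  forall XY YZ L R : objS K,
    is_generic_extension Y Z YZ -> is_generic_extension X YZ L ->
    is_generic_extension X Y XY -> is_generic_extension XY Z R ->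
    isoS L R.
Proof.
move=> X1 Y1 Z1 XY YZ L R genYZ genL genXY genR; apply: iso_isoS.
have gX := admissible_triple_of X1; have gY := admissible_triple_of Y1.
have gZ := admissible_triple_of Z1.
have XY1 : in_S1 XY by case: genXY => -[].
have [c0 c0_van isoYZ] := extension_glue Y1 genYZ.1.
have [G0 G0_van isoL_] := extension_glue X1 genL.1.
have [F0 /(_ G0_van) F0_van isoL__] := glue_isol G0 isoYZ.
have isoL := iso_trans isoL_ isoL__.
have [e1 e1_van isoXY] := extension_glue X1 genXY.1.
have [G1 G1_van isoR_] := extension_glue XY1 genR.1.
have [C1 /(_ G1_van) C1_van isoR__] := glue_isor G1 isoXY.
have isoR' := iso_trans isoR_ isoR__.
pose x := triple_of X; pose y := triple_of Y; pose z := triple_of Z.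
(* R is regrouped to the same shape (Z + Y) + X as L. *)
pose c1 : 'Hom(carrier y, carrier z) := linfun (fun v : carrier y => C1 (v, 0)).
pose F1 : 'Hom(carrier x, (carrier z * carrier y)%type) :=
  linfun (fun w : carrier x => (C1 (0, w), e1 w)).
have c1E v : c1 v = C1 (v, 0).
  rewrite linfunE // => a u w; rewrite -linearP; congr (C1 (_, _)).
  by rewrite /= scaler0 addr0.
have F1E w : F1 w = (C1 (0, w), e1 w).
  rewrite linfunE // => a u v; congr (_, _); rewrite /= ?linearP //.
  by rewrite -linearP; congr (C1 (_, _)); rewrite /= scaler0 addr0.
have isoR : iso (triple_of R) (glue3 c1 F1).
  apply: (iso_trans isoR'); apply/iso_sym/glue_assoc => [w|v w]; first by rewrite F1E.
  rewrite c1E F1E /= -linearD; congr (C1 (_, _)); by rewrite /= ?addr0 ?add0r.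
pose c t : 'Hom(carrier y, carrier z) := line c0 c1 t.
pose F t : 'Hom(carrier x, (carrier z * carrier y)%type) := line F0 F1 t.
pose e t : 'Hom(carrier x, carrier y) := line (linfun (fun w => (F0 w).2)) e1 t.
pose W t := glue3 (c t) (F t).
have eE t w : (F t w).2 = e t w.
  by rewrite /F /e !lineE F1E linfunE // => a u v; rewrite linearP.
(* W t runs from L at t = 0 to R at t = 1. *)
have W0 : W 0 = glue3 c0 F0 by rewrite /W /c /F !line0.
have W1 : W 1 = glue3 c1 F1 by rewrite /W /c /F !line1.
have [|t [[t_L t_R] [t_YZ t_XY]]] := closed_generic (P := fun t =>
  ((forall n, fdim (W t) n <= fdim (W 0%R) n)%N /\
   (forall n, fdim (W t) n <= fdim (W 1%R) n)%N) /\
  ((forall n, fdim (glue (c t)) n <= fdim (glue (c 0%R)) n)%N /\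
   (forall n, fdim (glue (e t)) n <= fdim (glue (e 1%R)) n)%N)).
  by do !apply: generically_and; [exact: generic_glue3 | exact: generic_glue3
    | exact: generic_glue | exact: generic_glue].
have cE : c 0 = c0 := line0 _ _; have e1E : e 1 = e1 := line1 _ _.
rewrite W0 in t_L; rewrite W1 in t_R; rewrite cE in t_YZ; rewrite e1E in t_XY.
have c_van : vanishes (c t).
  move=> u uy; rewrite /c lineE /line c0_van // c1E C1_van ?subrr ?scaler0 ?addr0 //.
  by rewrite mem_prodv /= uy mem0v.
have F_van : vanishes (B := x) (F t).
  move=> u ux; rewrite /F lineE /line F0_van // F1E C1_van ?e1_van ?subrr ?scaler0 ?addr0 //.
  by rewrite mem_prodv /= ux mem0v.
have e_van : vanishes (e t).
  by move=> u ux; rewrite -eE F_van.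
have admissible_c : admissible (glue (c t)) by apply: admissible_glue.
have admissible_e : admissible (glue (e t)) by apply: admissible_glue.
have admissible_W : admissible (W t) by apply: admissible_glue.
have iso_c : iso (glue (c t)) (triple_of YZ).
  exact: (generic_extension_iso genYZ isoYZ admissible_c (iso_refl _)).
have iso_e : iso (glue (e t)) (triple_of XY).
  exact: (generic_extension_iso genXY isoXY admissible_e (iso_refl _)).
have isoWL : iso (W t) (triple_of L).
  have [C' _ isoC'] := @glue_isol K (glue (c t)) (triple_of YZ) x (F t) iso_c.
  exact: (generic_extension_iso genL isoL admissible_W isoC').
apply: iso_trans (iso_sym isoWL) _.
pose Ce : 'Hom((carrier y * carrier x)%type, carrier z) :=
  linfun (fun p : carrier y * carrier x => c t p.1 + (F t p.2).1).
have CeE v w : Ce (v, w) = c t v + (F t w).1.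
  by rewrite linfunE // => a p q; rewrite /= !linearP scalerDr addrACA.
(* The same triple, seen as an extension of its quotient on Y + X by Z. *)
have isoCe := glue_assoc (eE t) CeE.
have [C' _ isoC'] := @glue_isor K z (glue (e t)) (triple_of XY) Ce iso_e.
exact: (generic_extension_iso genR isoR admissible_W (iso_trans isoCe isoC')).
Qed.
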